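(* Let $\mathscr{O}$ be a discrete valuation ring with fraction field $\mathscr{K}$ and residue field $\mathbb{K}$ of characteristic different from $2$, and let $\mathcal{A}$ be an $\mathscr{O}$-superalgebra which is free of finite rank as an $\mathscr{O}$-module. Suppose $\mathbb{K}\mathcal{A}$ and $\mathscr{K}\mathcal{A}$ are split and $\mathbb{K}\mathcal{A}$ is semisimple. Then: (1) Suppose all simple $\mathscr{K}\mathcal{A}$-modules are of type $\mathtt{M}$. Then there is a bijection $\mathrm{Irr}(\mathscr{K}\mathcal{A})\to\mathrm{Irr}(\mathbb{K}\mathcal{A})$, $V\mapsto\mathbb{K}\tilde V$, and all simple $\mathbb{K}\mathcal{A}$-modules are of type $\mathtt{M}$. (2) Suppose $\mathscr{O}$ is complete. Then there is a bijection $\mathrm{Irr}(\mathscr{K}\mathcal{A})\to\mathrm{Irr}(\mathbb{K}\mathcal{A})$, $V\mapsto\mathbb{K}\tilde V$, which sends simple $\mathscr{K}\mathcal{A}$-modules of type $\mathtt{M}$ to simple $\mathbb{K}\mathcal{A}$-modules of type $\mathtt{M}$ and simple $\mathscr{K}\mathcal{A}$-modules of type $\mathtt{Q}$ to simple $\mathbb{K}\mathcal{A}$-modules of type $\mathtt{Q}$.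
   Context: $\mathscr{K}\mathcal{A}=\mathscr{K}\otimes_{\mathscr{O}}\mathcal{A}$, $\mathbb{K}\mathcal{A}=\mathbb{K}\otimes_{\mathscr{O}}\mathcal{A}$. A superalgebra is a $\mathbb{Z}_2$-graded associative algebra; modules are $\mathbb{Z}_2$-graded finite-dimensional left modules, and a homogeneous homomorphism $f$ satisfies $f(av)=(-1)^{|f||a|}af(v)$ (general homomorphisms are sums of homogeneous ones, so odd isomorphisms are allowed). $\mathrm{Irr}(-)$ is a complete set of pairwise non-isomorphic simple (graded) modules. A superalgebra over a field is semisimple if its ordinary (ungraded) Jacobson radical is $0$. A simple module is split if it stays simple after every field extension; a finite-dimensional superalgebra is split if all its simple modules are. In that case a simple module is of type $\mathtt{M}$ (resp. $\mathtt{Q}$) if its full super endomorphism algebra is one-dimensional (resp. two-dimensional). For each $\mathbb{Z}_2$-graded $\mathscr{K}\mathcal{A}$-module $V$, a $\mathbb{Z}_2$-graded $\mathcal{A}$-submodule $\tilde V\subset V$, free of finite rank over $\mathscr{O}$ with $\mathscr{K}\otimes_{\mathscr{O}}\tilde V\cong V$, is fixed; $\mathbb{K}\tilde V=\mathbb{K}\otimes_{\mathscr{O}}\tilde V$. *)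

(* Defs.v *)
From HB Require Import structures.
From mathcomp Require Import all_boot all_algebra.
From mathcomp Require Import boolp classical_sets.

Set Implicit Arguments.
Unset Strict Implicit.
Unset Printing Implicit Defensive.

Import GRing.Theory.
Local Open Scope ring_scope.
Local Open Scope quotient_scope.

(** * Superspaces, superalgebras and supermodules *)

(* A Z_2-grading V = V_0 (+) V_1 is given by its two component projections:
   [spart b v] is the component of v in V_b ([false] = even, [true] = odd).
   All superspaces are free of finite rank over the base ring, which is how
   mathcomp's [vectType] reads over a ring. *)
HB.mixin Record isSuperSpace (R : nzRingType) V of GRing.Lmodule R V := {
  spart : bool -> V -> V;
  spart_is_linear : forall b, linear (spart b);
  spartK : forall b c v, spart b (spart c v) = if b == c then spart c v else 0;
  spartD : forall v, spart false v + spart true v = v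
}.
#[short(type="superSpaceType")]
HB.structure Definition SuperSpace (R : nzRingType) :=
  {V of isSuperSpace R V & Vector R V}.

(* v belongs to V_b *)
Definition homog (R : nzRingType) (V : superSpaceType R) (b : bool) (v : V) :=
  spart b v = v.

(* The product is not taken from mathcomp's [algType], because that structure
   excludes the zero algebra. *)
HB.mixin Record isSuperAlgebra (R : comNzRingType) A of SuperSpace R A := {
  sone : A;
  smul : A -> A -> A;
  smul_linear_l : forall b : A, linear (smul^~ b);
  smul_linear_r : forall a : A, linear (smul a);
  smulA : associative smul;
  smul1x : left_id sone smul;
  smulx1 : right_id sone smul;
  smul_homog : forall b c (x y : A),
    homog b x -> homog c y -> homog (b (+) c) (smul x y)
}.
#[short(type="superAlgType")]
HB.structure Definition SuperAlgebra (R : comNzRingType) :=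
  {A of isSuperAlgebra R A & SuperSpace R A}.

HB.mixin Record isSuperModule (R : comNzRingType) (A : superAlgType R) V
    of SuperSpace R V := {
  sact : A -> V -> V;
  sact_linear_l : forall v : V, linear (sact^~ v);
  sact_linear_r : forall a : A, linear (sact a);
  sactA : forall (a b : A) (v : V), sact (smul a b) v = sact a (sact b v);
  sact1 : forall v : V, sact sone v = v;
  sact_homog : forall b c (x : A) (v : V),
    homog b x -> homog c v -> homog (b (+) c) (sact x v)
}.
#[short(type="superModType")]
HB.structure Definition SuperModule (R : comNzRingType) (A : superAlgType R) :=
  {V of isSuperModule R A V & SuperSpace R V}.

(** * Extension of scalars *)

(* [ext phi M] is F (x)_O M, for F an O-algebra through phi : O -> F. Its
   elements are finite sums of symbols f (x) m, coded as lists of pairs (f, m);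
   two sums are identified when every O-linear map h from M to an F-module
   gives them the same value \sum f *: h m. By the universal property (applied
   to h m = 1 (x) m) this is equality in the tensor product. *)
Section Ext.
Variables (O F : comNzRingType) (phi : {rmorphism O -> F}).

Definition semilin (M : lmodType O) (W : lmodType F) (h : M -> W) :=
  linear_for (phi \; *:%R) h.

Section Module.
Variable M : lmodType O.

Definition ext_sum (W : lmodType F) (h : M -> W) (s : seq (F * M)) : W :=
  \sum_(p <- s) p.1 *: h p.2.

Definition ext_eq : rel (seq (F * M)) := fun s t =>
  `[< forall (W : lmodType F) (h : M -> W), semilin h ->
      ext_sum h s = ext_sum h t >].

Lemma ext_eq_refl : reflexive ext_eq.
Proof. by move=> s; apply/asboolP. Qed.

Lemma ext_eq_sym : symmetric ext_eq.
Proof.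
by move=> s t; apply/asboolP/asboolP => H W h hl; rewrite (H W h hl).
Qed.

Lemma ext_eq_trans : transitive ext_eq.
Proof.
move=> t s u /asboolP Hst /asboolP Htu; apply/asboolP => W h hl.
by rewrite (Hst W h hl) (Htu W h hl).
Qed.

Canonical ext_equiv := EquivRel ext_eq ext_eq_refl ext_eq_sym ext_eq_trans.

Definition ext := {eq_quot ext_equiv}.
HB.instance Definition _ := EqQuotient.on ext.
HB.instance Definition _ := Choice.on ext.

Definition ext_mk (s : seq (F * M)) : ext := \pi_ext s.

(* the F-linear map F (x) M -> W induced by h : M -> W *)
Definition ext_lift (W : lmodType F) (h : M -> W) (x : ext) : W :=
  ext_sum h (repr x).

Lemma ext_lift_mk (W : lmodType F) (h : M -> W) s :
  semilin h -> ext_lift h (ext_mk s) = ext_sum h s.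
Proof.
move=> hl; rewrite /ext_lift /ext_mk.
have /eqmodP /asboolP -> // : repr (\pi_ext s) = s %[mod ext] by rewrite reprK.
Qed.

Lemma extP (x y : ext) :
  (forall (W : lmodType F) (h : M -> W), semilin h ->
     ext_lift h x = ext_lift h y) -> x = y.
Proof.
move=> H; rewrite -[x]reprK -[y]reprK; apply/eqmodP/asboolP => W h hl.
exact: H.
Qed.

Definition ext0 := ext_mk [::].
Definition ext_add (x y : ext) := ext_mk (repr x ++ repr y).
Definition ext_opp (x : ext) := ext_mk [seq (- p.1, p.2) | p <- repr x].
Definition ext_scale (a : F) (x : ext) := ext_mk [seq (a * p.1, p.2) | p <- repr x].

Section Lift.
Variables (W : lmodType F) (h : M -> W).
Hypothesis hl : semilin h.

Lemma ext_lift0 : ext_lift h ext0 = 0.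
Proof. by rewrite ext_lift_mk // /ext_sum big_nil. Qed.

Lemma ext_lift_add x y :
  ext_lift h (ext_add x y) = ext_lift h x + ext_lift h y.
Proof. by rewrite ext_lift_mk // /ext_sum big_cat. Qed.

Lemma ext_lift_opp x : ext_lift h (ext_opp x) = - ext_lift h x.
Proof.
rewrite ext_lift_mk // /ext_sum big_map -sumrN.
by apply: eq_bigr => p _; rewrite scaleNr.
Qed.

Lemma ext_lift_scale a x : ext_lift h (ext_scale a x) = a *: ext_lift h x.
Proof.
rewrite ext_lift_mk // /ext_sum big_map scaler_sumr.
by apply: eq_bigr => p _; rewrite scalerA.
Qed.

End Lift.

Fact ext_addA : associative ext_add.
Proof. by move=> x y z; apply: extP => W h hl; rewrite !ext_lift_add ?addrA. Qed.
Fact ext_addC : commutative ext_add.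
Proof. by move=> x y; apply: extP => W h hl; rewrite !ext_lift_add // addrC. Qed.
Fact ext_add0 : left_id ext0 ext_add.
Proof.
by move=> x; apply: extP => W h hl; rewrite ext_lift_add ?ext_lift0 ?add0r.
Qed.
Fact ext_addN : left_inverse ext0 ext_opp ext_add.
Proof.
move=> x; apply: extP => W h hl.
by rewrite ext_lift_add // ext_lift_opp // ext_lift0 // addNr.
Qed.

HB.instance Definition _ :=
  GRing.isZmodule.Build ext ext_addA ext_addC ext_add0 ext_addN.

Fact ext_scaleA a b x : ext_scale a (ext_scale b x) = ext_scale (a * b) x.
Proof. by apply: extP => W h hl; rewrite !ext_lift_scale // scalerA. Qed.
Fact ext_scale1 : left_id 1 ext_scale.
Proof. by move=> x; apply: extP => W h hl; rewrite ext_lift_scale // scale1r. Qed.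
Fact ext_scaleDr : right_distributive ext_scale +%R.
Proof.
move=> a x y; apply: extP => W h hl.
by rewrite !(ext_lift_add, ext_lift_scale) // scalerDr.
Qed.
Fact ext_scaleDl v : {morph ext_scale^~ v : a b / a + b}.
Proof.
move=> a b; apply: extP => W h hl.
by rewrite !(ext_lift_add, ext_lift_scale) // scalerDl.
Qed.

HB.instance Definition _ := GRing.Zmodule_isLmodule.Build F ext
  ext_scaleA ext_scale1 ext_scaleDr ext_scaleDl.

Lemma ext_lift_linear (W : lmodType F) (h : M -> W) :
  semilin h -> linear (ext_lift h).
Proof.
by move=> hl a x y; rewrite ext_lift_add // ext_lift_scale.
Qed.

(* the pure tensor 1 (x) m *)
Definition tens1 (m : M) : ext := ext_mk [:: (1, m)].

Lemma ext_lift_tens1 (W : lmodType F) (h : M -> W) m :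
  semilin h -> ext_lift h (tens1 m) = h m.
Proof. by move=> hl; rewrite ext_lift_mk // /ext_sum big_seq1 scale1r. Qed.

Lemma tens1_semilin : semilin tens1.
Proof.
move=> a u v; apply: extP => W h hl /=.
by rewrite ext_lift_linear // !ext_lift_tens1 // hl.
Qed.

Lemma extE (x : ext) : x = \sum_(p <- repr x) p.1 *: tens1 p.2.
Proof.
apply: extP => W h hl; rewrite /ext_lift /ext_sum -/(ext_sum h (repr x)).
set s := repr x; elim: s => [|p s IH].
  by rewrite big_nil /ext_sum big_nil -/(ext_sum _ _) -/(ext_lift h 0) ext_lift0.
rewrite [RHS](_ : _ = ext_lift h (\sum_(q <- p :: s) q.1 *: tens1 q.2)) //.
rewrite big_cons ext_lift_linear // ext_lift_tens1 //.
by rewrite /ext_sum big_cons; congr (_ + _); exact: IH.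
Qed.

Lemma ext_ind (P : ext -> Prop) :
  (forall m, P (tens1 m)) -> P 0 ->
  (forall a x y, P x -> P y -> P (a *: x + y)) -> forall x, P x.
Proof.
move=> P1 P0 PD x; rewrite [x]extE; elim: (repr x) => [|p s IH].
  by rewrite big_nil.
by rewrite big_cons; apply: PD.
Qed.

Lemma ext_linear_eq (W : lmodType F) (f g : ext -> W) :
  linear f -> linear g -> (forall m, f (tens1 m) = g (tens1 m)) -> f =1 g.
Proof.
move=> fl gl fg; elim/ext_ind => // [|a x y fgx fgy].
  by rewrite -[0](subrr 0) -scaleN1r addrC fl gl !scaleN1r !addNr.
by rewrite fl gl fgx fgy.
Qed.

End Module.

(* F (x) M is free of finite rank over F when M is over O. *)
Section Vect.
Variable M : vectType O.
Import VectorInternalTheory.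

Let coor (m : M) : 'rV[F]_(dim M) := map_mx phi (v2r m).

Let coor_semilin : semilin coor.
Proof. by move=> a u v; rewrite /coor linearP map_mxD map_mxZ. Qed.

Let uncoor (c : 'rV[F]_(dim M)) : ext M :=
  \sum_i c 0 i *: tens1 (r2v (delta_mx 0 i)).

Let uncoor_linear : linear uncoor.
Proof.
move=> a u v; rewrite /uncoor scaler_sumr -big_split; apply: eq_bigr => i _ /=.
by rewrite !mxE scalerDl scalerA.
Qed.

Fact ext_vect_axiom : Vector.axiom (dim M) (ext M).
Proof.
exists (ext_lift coor); first exact: ext_lift_linear.
have sl := @tens1_semilin M.
have lin := ext_lift_linear coor_semilin.
exists uncoor => [x|c].
  move: x; apply: ext_linear_eq => //= [a x y|m].
    by rewrite lin uncoor_linear.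
  rewrite ext_lift_tens1 // /uncoor -{2}[m]v2rK [v2r m]row_sum_delta.
  rewrite linear_sum /=.
  pose Phi : {linear M -> ext M | phi \; *:%R} :=
    HB.pack (@tens1 M) (GRing.isLinear.Build _ _ _ _ (@tens1 M) sl).
  rewrite -[RHS]/(Phi _) linear_sum; apply: eq_bigr => i _.
  by rewrite !linearZ /= !mxE.
pose L : {linear ext M -> 'rV[F]_(dim M)} :=
  HB.pack (ext_lift coor) (GRing.isLinear.Build _ _ _ _ (ext_lift coor) lin).
rewrite -[LHS]/(L _) /uncoor linear_sum [RHS]row_sum_delta.
apply: eq_bigr => i _; rewrite linearZ /= ext_lift_tens1 //.
by rewrite /coor r2vK map_delta_mx.
Qed.

HB.instance Definition _ := Lmodule_hasFinDim.Build F (ext M) ext_vect_axiom.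

End Vect.

(* F-bilinear extension of an O-bilinear map g : M -> N -> P, characterised by
   (1 (x) m, 1 (x) n) |-> 1 (x) g m n. *)
Section Bilinear.
Variables (M N P : lmodType O) (g : M -> N -> P).
Hypothesis gl : forall n, linear (g^~ n).
Hypothesis gr : forall m, linear (g m).

Definition ext_bil (x : ext M) (y : ext N) : ext P :=
  ext_lift (fun m => ext_lift (fun n => tens1 (g m n)) y) x.

Let inner_semilin m : semilin (fun n => tens1 (g m n)).
Proof. by move=> a u v; rewrite gr tens1_semilin. Qed.

Let outer_semilin y :
  semilin (fun m => ext_lift (fun n => tens1 (g m n)) y).
Proof.
move=> a u v /=; move: y; apply: ext_linear_eq.
- exact: ext_lift_linear.
- move=> b x y; rewrite !ext_lift_linear // !scalerDr !scalerA.
  by rewrite [phi a * b]mulrC addrACA.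
- by move=> n; rewrite !ext_lift_tens1 // gl tens1_semilin.
Qed.

Lemma ext_bil_linear_l y : linear (ext_bil^~ y).
Proof. exact: ext_lift_linear. Qed.

Lemma ext_bil_linear_r x : linear (ext_bil x).
Proof.
move=> a y z; rewrite /ext_bil; move: x; apply: ext_linear_eq.
- exact: ext_lift_linear.
- move=> b x x'; rewrite !ext_lift_linear // !scalerDr !scalerA.
  by rewrite [a * b]mulrC addrACA.
- by move=> m; rewrite !ext_lift_tens1 // ext_lift_linear.
Qed.

Lemma ext_bil_tens1 m n : ext_bil (tens1 m) (tens1 n) = tens1 (g m n).
Proof. by rewrite /ext_bil !ext_lift_tens1. Qed.

End Bilinear.

Section Super.
Variable V : superSpaceType O.

Definition ext_spart (b : bool) : ext V -> ext V :=
  ext_lift (fun v => tens1 (spart b v)).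

Let spart_semilin b : semilin (fun v : V => tens1 (spart b v)).
Proof. by move=> a u v; rewrite spart_is_linear tens1_semilin. Qed.

Fact ext_spart_linear b : linear (ext_spart b).
Proof. exact: ext_lift_linear. Qed.

Lemma ext_spart_tens1 b v : ext_spart b (tens1 v) = tens1 (spart b v).
Proof. exact: ext_lift_tens1. Qed.

Fact ext_spartK b c v :
  ext_spart b (ext_spart c v) = if b == c then ext_spart c v else 0.
Proof.
move: v; apply: ext_linear_eq => [a x y|a x y|v].
- by rewrite !ext_spart_linear.
- by case: ifP => _; rewrite ?ext_spart_linear // scaler0 addr0.
rewrite !ext_spart_tens1 spartK; case: ifP => // _.
have := tens1_semilin (-1) (0 : V) 0.
by rewrite scaler0 addr0 /= rmorphN1 scaleN1r addNr.
Qed.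

Fact ext_spartD v : ext_spart false v + ext_spart true v = v.
Proof.
move: v; apply: ext_linear_eq => [a x y|a x y|v] //.
- by rewrite !ext_spart_linear scalerDr addrACA.
rewrite !ext_spart_tens1 -[in RHS](spartD v).
by have := tens1_semilin 1 (spart false v) (spart true v);
  rewrite scale1r /= rmorph1 scale1r => ->.
Qed.

HB.instance Definition _ := isSuperSpace.Build F (ext V)
  ext_spart_linear ext_spartK ext_spartD.

End Super.

Lemma ext_bil_homog (U V W : superSpaceType O) (g : U -> V -> W) b c
    (x : ext U) (y : ext V) :
  (forall v, linear (g^~ v)) -> (forall u, linear (g u)) ->
  (forall u v, homog b u -> homog c v -> homog (b (+) c) (g u v)) ->
  homog b x -> homog c y -> homog (b (+) c) (ext_bil g x y).
Proof.
move=> gl gr gh <- <-; rewrite /homog.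
have L := ext_bil_linear_l gl gr; have R := ext_bil_linear_r gl gr.
have S (Z : superSpaceType F) : forall d, linear (@spart F Z d) :=
  @spart_is_linear F Z.
move: x; apply: ext_linear_eq => [a x x'|a x x'|u].
- by rewrite S L S.
- by rewrite S L.
move: y; apply: ext_linear_eq => [a y y'|a y y'|v].
- by rewrite S R S.
- by rewrite S R.
rewrite /= /spart /= !ext_spart_tens1 ext_bil_tens1 // ext_spart_tens1.
by congr tens1; apply: gh; rewrite /homog spartK eqxx.
Qed.

Section Algebra.
Variable A : superAlgType O.

Definition ext_one : ext A := tens1 sone.
Definition ext_smul : ext A -> ext A -> ext A := ext_bil smul.

Let L := ext_bil_linear_l (@smul_linear_l _ A) (@smul_linear_r _ A).
Let R := ext_bil_linear_r (@smul_linear_l _ A) (@smul_linear_r _ A).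
Let T := ext_bil_tens1 (@smul_linear_l _ A) (@smul_linear_r _ A).

Fact ext_smulA : associative ext_smul.
Proof.
move=> x y z; rewrite /ext_smul.
move: x; apply: ext_linear_eq => [a x x'|a x x'|u]; rewrite ?L //.
move: y; apply: ext_linear_eq => [a y y'|a y y'|v]; rewrite ?(L, R) //.
move: z; apply: ext_linear_eq => [a z z'|a z z'|w]; rewrite ?R //.
by rewrite !T smulA.
Qed.

Fact ext_smul1x : left_id ext_one ext_smul.
Proof.
apply: ext_linear_eq => [a x x'|a x x'|u] //; first exact: R.
by rewrite /ext_smul T smul1x.
Qed.

Fact ext_smulx1 : right_id ext_one ext_smul.
Proof.
apply: ext_linear_eq => [a x x'|a x x'|u] //; first exact: L.
by rewrite /ext_smul T smulx1.
Qed.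

Fact ext_smul_homog b c (x y : ext A) :
  homog b x -> homog c y -> homog (b (+) c) (ext_smul x y).
Proof.
apply: ext_bil_homog; [exact: smul_linear_l|exact: smul_linear_r|].
exact: smul_homog.
Qed.

HB.instance Definition _ := isSuperAlgebra.Build F (ext A)
  L R ext_smulA ext_smul1x ext_smulx1 ext_smul_homog.

Variable V : superModType A.

Definition ext_act : ext A -> ext V -> ext V := ext_bil (@sact _ A V).

Let aL := ext_bil_linear_l (@sact_linear_l _ A V) (@sact_linear_r _ A V).
Let aR := ext_bil_linear_r (@sact_linear_l _ A V) (@sact_linear_r _ A V).
Let aT := ext_bil_tens1 (@sact_linear_l _ A V) (@sact_linear_r _ A V).

Fact ext_actA x y v : ext_act (smul x y) v = ext_act x (ext_act y v).
Proof.
rewrite /ext_act -[smul x y]/(ext_bil smul x y).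
move: x; apply: ext_linear_eq => [a x x'|a x x'|u]; rewrite ?(L, aL) //.
move: y; apply: ext_linear_eq => [a y y'|a y y'|w]; rewrite ?(R, aL, aR) //.
move: v; apply: ext_linear_eq => [a z z'|a z z'|v]; rewrite ?aR //.
by rewrite T !aT sactA.
Qed.

Fact ext_act1 v : ext_act sone v = v.
Proof.
move: v; apply: ext_linear_eq => [a x x'|a x x'|u] //; first exact: aR.
by rewrite /ext_act aT sact1.
Qed.

Fact ext_act_homog b c (x : ext A) (v : ext V) :
  homog b x -> homog c v -> homog (b (+) c) (ext_act x v).
Proof.
apply: ext_bil_homog; [exact: sact_linear_l|exact: sact_linear_r|].
exact: sact_homog.
Qed.

HB.instance Definition _ := isSuperModule.Build F (ext A) (ext V)
  aL aR ext_actA ext_act1 ext_act_homog.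

End Algebra.

End Ext.

(** * Homomorphisms, simple modules, types *)

Section Hom.
Variables (R : comNzRingType) (A : superAlgType R).

(* homogeneous homomorphism of parity d *)
Definition homog_hom (V W : superModType A) (d : bool) (f : V -> W) :=
  [/\ linear f,
      forall b v, homog b v -> homog (b (+) d) (f v)
    & forall b (a : A) v, homog b a ->
        f (sact a v) = (-1) ^+ (d && b) *: sact a (f v)].

Definition superhom (V W : superModType A) (f : V -> W) :=
  exists f0 f1 : V -> W,
    [/\ homog_hom false f0, homog_hom true f1 & forall v, f v = f0 v + f1 v].

Definition siso (V W : superModType A) :=
  exists (f : V -> W) (g : W -> V),
    [/\ superhom f, superhom g, cancel f g & cancel g f].

Definition graded_submodule (V : superModType A) (U : set V) :=
  [/\ U 0, forall u v, U u -> U v -> U (u + v),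
      forall (r : R) u, U u -> U (r *: u),
      forall (a : A) u, U u -> U (sact a u)
    & forall b u, U u -> U (spart b u)].

Definition simple_mod (V : superModType A) :=
  (exists v : V, v <> 0) /\
  forall U : set V, graded_submodule U -> U = [set 0]%classic \/ U = setT.

(* A complete set of pairwise non-isomorphic simple modules, as a family. *)
Definition is_Irr (I : Type) (V : I -> superModType A) :=
  [/\ forall i, simple_mod (V i),
      forall i j, siso (V i) (V j) -> i = j
    & forall W : superModType A, simple_mod W -> exists i, siso W (V i)].

(* the full super endomorphism algebra of V has an R-basis of n elements *)
Definition endo_dim (V : superModType A) (n : nat) :=
  exists e : 'I_n -> (V -> V), (forall i, superhom (e i)) /\
    forall f : V -> V, superhom f ->
      exists! c : 'rV[R]_n, forall v, f v = \sum_i c 0 i *: e i v.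

(* These are used only for simple modules over split superalgebras. *)
Definition typeM (V : superModType A) := endo_dim V 1.
Definition typeQ (V : superModType A) := endo_dim V 2.

(* ungraded left ideals *)
Definition left_ideal (I : set A) :=
  [/\ I 0, forall x y, I x -> I y -> I (x + y)
    & forall a x, I x -> I (smul a x)].

Definition maximal_left_ideal (I : set A) :=
  [/\ left_ideal I, I <> setT
    & forall J, left_ideal J -> (I `<=` J)%classic -> J = I \/ J = setT].

Definition jacobson_radical : set A :=
  fun x => forall I, maximal_left_ideal I -> I x.

Definition semisimple := jacobson_radical = [set 0]%classic.

End Hom.

Definition split_mod (F : fieldType) (A : superAlgType F)
    (V : superModType A) :=
  forall (L : fieldType) (iota : {rmorphism F -> L}),
    simple_mod (ext iota V : superModType (ext iota A)).

Definition split_alg (F : fieldType) (A : superAlgType F) :=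
  forall V : superModType A, simple_mod V -> split_mod V.

(** * Discrete valuation rings *)

Section DVR.
Variable O : idomainType.

Definition ideal (I : set O) :=
  [/\ I 0, forall x y, I x -> I y -> I (x + y) & forall a x, I x -> I (a * x)].

Definition principal (I : set O) :=
  exists a, forall x, I x <-> exists b, x = b * a.

Definition maximal_ideal (I : set O) :=
  [/\ ideal I, I <> setT
    & forall J, ideal J -> (I `<=` J)%classic -> J = I \/ J = setT].

(* O is a discrete valuation ring with maximal ideal m: a local principal
   ideal domain which is not a field. *)
Definition is_DVR (m : set O) :=
  [/\ forall I, ideal I -> principal I,
      maximal_ideal m, forall I, maximal_ideal I -> I = m
    & m <> [set 0]%classic].

Fixpoint ideal_pow (I : set O) (n : nat) : set O :=
  if n is n'.+1 then
    fun x => exists s : seq (O * O),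
      (forall p, p \in s -> I p.1 /\ ideal_pow I n' p.2) /\
      x = \sum_(p <- s) p.1 * p.2
  else setT.

(* The canonical map from O to the inverse limit of the O / m^n is bijective. *)
Definition adic_complete (m : set O) :=
  forall x : nat -> O, (forall n, ideal_pow m n (x n.+1 - x n)) ->
  exists! l : O, forall n, ideal_pow m n (l - x n).

(* k is the residue field O / m, with quotient map res. *)
Definition is_residue_field (m : set O) (k : fieldType)
    (res : {rmorphism O -> k}) :=
  (forall y, exists x, res x = y) /\ (forall x, res x = 0 <-> m x).

End DVR.

Definition frac_map (O : idomainType) : {rmorphism O -> {fraction O}} :=
  @tofrac O.
Arguments frac_map O : clear implicits.

(* A graded A-submodule of V, free of finite rank over O and spanning V over
   the fraction field K: K (x)_O lat ~= V. *)
Record lattice (O : idomainType) (A : superAlgType O)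
    (V : superModType (ext (frac_map O) A)) := Lattice {
  lat :> superModType A;
  lat_incl : lat -> V;
  lat_incl_inj : injective lat_incl;
  lat_incl_linear : semilin (frac_map O) lat_incl;
  lat_incl_act : forall a x,
    lat_incl (sact a x) = sact (tens1 (frac_map O) a) (lat_incl x);
  lat_incl_spart : forall b x, lat_incl (spart b x) = spart b (lat_incl x);
  lat_span : siso (ext (frac_map O) lat : superModType (ext (frac_map O) A)) V
}.

(* Main.v *)
Require Import Defs.
From HB Require Import structures.
From mathcomp Require Import all_boot all_algebra all_field.
From mathcomp Require Import boolp classical_sets.

Set Implicit Arguments.
Unset Strict Implicit.
Unset Printing Implicit Defensive.

Import GRing.Theory VectorInternalTheory.
Local Open Scope ring_scope.

(** Write KA and kA for the extensions of A to the fraction field K and to the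
    residue field k, and call supermodules M, N over A, free of finite rank over O,
    lattices.  Everything follows from one comparison: for all lattices M and N, the
    homomorphisms KM -> KN and kM -> kN form spaces of the same dimension
    ([rank_hom_eq]), also in each parity ([rank_hom_deg_eq]).

    To see this, put both spaces at the start of the Hochschild complex
    Hom(M,N) -> Hom(A,Hom(M,N)) -> Hom(A (x) A,Hom(M,N)), whose second kernel is the
    space of derivations.  The two maps are matrices over O.  The rank of such a
    matrix over K is at least its rank over k, because a minor that is nonzero in k
    is nonzero in O ([rank_specialise]).  As kA is semisimple, every derivation over
    k is inner ([derivation_inner], from dual bases of kA-modules), so the complex
    is exact over k; over K the two ranks still add up to at most the dimension of
    the middle term.  Hence the ranks over K and k agree ([rank_exact]).  The even
    and odd parts of the Hom spaces can only grow under reduction, and their sum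
    does not, so both stay the same.

    The sign rule is handled by composing odd maps with the parity involution:
    this turns superhomomorphisms into ordinary homomorphisms of the underlying
    ungraded modules, and identifies the full superendomorphism algebra with the
    ungraded one as a vector space ([endo_dim_rank]).  So types are preserved by
    reduction ([endo_dim_reduction]).

    Let V be simple over KA, with lattice M.  As V is split, its even endomorphisms
    are scalars: adjoin an eigenvalue ([split_even_scalar]).  The same then holds
    for kM, and a module over a semisimple algebra with only scalar even
    endomorphisms is simple ([simple_reduction]).  The comparison of Hom spaces and
    Schur's lemma show that V -> kM is injective on isomorphism classes.

    For surjectivity ([simple_lifts]) let S be simple over kA and let p be the
    identity element of its annihilator, lifted to c in A.  If S were isomorphic to
    no reduction, p would act injectively on all the kM with KM simple
    ([block_hom]), so the determinant of c on every simple KA-module would be an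
    element of O with nonzero residue.  Determinants are multiplicative along
    composition series ([det_by_simples]), so the same would hold on the regular
    module, and p would be invertible in kA.  But p kills S. *)

(** * Superspaces and unsigned homomorphisms *)

Section LinearFacts.
Variables (R : nzRingType) (U V : lmodType R) (f : U -> V).
Hypothesis fl : linear f.

Lemma linD u v : f (u + v) = f u + f v.
Proof. by have := fl 1 u v; rewrite !scale1r. Qed.
Lemma lin0 : f 0 = 0.
Proof. by apply: (addrI (f 0)); rewrite -linD !addr0. Qed.
Lemma linZ a u : f (a *: u) = a *: f u.
Proof. by have := fl a u 0; rewrite lin0 !addr0. Qed.
Lemma linN u : f (- u) = - f u.
Proof. by rewrite -scaleN1r linZ scaleN1r. Qed.
Lemma linB u v : f (u - v) = f u - f v.
Proof. by rewrite linD linN. Qed.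
Lemma lin_sum I (r : seq I) (P : pred I) (F : I -> U) :
  f (\sum_(i <- r | P i) F i) = \sum_(i <- r | P i) f (F i).
Proof. by elim/big_rec2: _ => [|i y x _ <-]; rewrite ?lin0 ?linD. Qed.

End LinearFacts.

Section LinearClosure.
Variables (R : nzRingType) (U V W : lmodType R).

Lemma lin_comp (f : V -> W) (g : U -> V) :
  linear f -> linear g -> linear (fun u => f (g u)).
Proof. by move=> fl gl a u v; rewrite gl fl. Qed.
Lemma lin_add (f g : U -> V) :
  linear f -> linear g -> linear (fun u => f u + g u).
Proof. by move=> fl gl a u v; rewrite gl fl scalerDr addrACA. Qed.
Lemma lin_opp (f : U -> V) : linear f -> linear (fun u => - f u).
Proof. by move=> fl a u v; rewrite fl opprD scalerN. Qed.
Lemma lin_bigsum I (r : seq I) (F : I -> U -> V) :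
  (forall i, linear (F i)) -> linear (fun u => \sum_(i <- r) F i u).
Proof.
move=> Fl a u v; rewrite scaler_sumr -big_split.
by apply: eq_bigr => i _; rewrite Fl.
Qed.

End LinearClosure.

HB.instance Definition _ (R : nzRingType) (V : superSpaceType R) b :=
  GRing.isLinear.Build R V V _ (@spart R V b) (@spart_is_linear R V b).
HB.instance Definition _ (R : comNzRingType) (A : superAlgType R)
    (V : superModType A) (a : A) :=
  GRing.isLinear.Build R V V _ (@sact R A V a) (@sact_linear_r R A V a).

Section Parity.
Variables (R : nzRingType) (V : superSpaceType R).
Implicit Types (b c : bool) (u v : V).

Lemma spart_id b v : spart b (spart b v) = spart b v.
Proof. by rewrite spartK eqxx. Qed.
Lemma spart_homog b v : homog b (spart b v).
Proof. exact: spart_id. Qed.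
Lemma homog_spart b c v : homog b v -> spart c v = if c == b then v else 0.
Proof. by move=> <-; rewrite spartK; case: eqP => // ->. Qed.
Lemma spartD_neg b v : spart b v + spart (~~ b) v = v.
Proof. by case: b; rewrite /= ?spartD // addrC spartD. Qed.

(** The sign twist v |-> (-1)^(b|v|) v. *)
Definition twist b v := if b then spart false v - spart true v else v.

Lemma twist_linear b : linear (twist b).
Proof.
case: b => //; apply: lin_add => //; first exact: spart_is_linear.
by apply: lin_opp; exact: spart_is_linear.
Qed.
Lemma twistK b : involutive (twist b).
Proof.
case: b => // v; rewrite /twist !linearB /= !spartK /= oppr0 sub0r opprK addr0.
exact: spartD.
Qed.
Lemma spart_twist b c v : spart c (twist b v) = (-1) ^+ (b && c) *: spart c v.
Proof.
case: b; last by rewrite expr0 scale1r.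
by case: c; rewrite /twist linearB /= !spartK /= ?expr0 ?expr1 ?scaleN1r
  ?scale1r ?subr0 ?sub0r.
Qed.
Lemma twist_homog b c v : homog c v -> twist b v = (-1) ^+ (b && c) *: v.
Proof. by move=> h; rewrite -{2}h -spart_twist -{1}h; case: b; case: c h => h;
  rewrite /twist ?spart_id // !linearB /= !spartK /= ?subr0 ?sub0r.
Qed.

End Parity.

Section ModuleFacts.
Variables (R : comNzRingType) (A : superAlgType R) (V : superModType A).
Implicit Types (a : A) (v : V).

Lemma sactDl a a' v : sact (a + a') v = sact a v + sact a' v.
Proof. exact: (linD (sact_linear_l v)). Qed.
Lemma sact0l v : sact (0 : A) v = 0.
Proof. exact: (lin0 (sact_linear_l v)). Qed.
Lemma sactZl r a v : sact (r *: a) v = r *: sact a v.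
Proof. exact: (linZ (sact_linear_l v)). Qed.
Lemma sactBl a a' v : sact (a - a') v = sact a v - sact a' v.
Proof. exact: (linB (sact_linear_l v)). Qed.

Lemma spart_sact e a v : spart e (sact a v) =
  sact (spart false a) (spart e v) + sact (spart true a) (spart (~~ e) v).
Proof.
have H b c : spart e (sact (spart b a) (spart c v)) =
    if e == b (+) c then sact (spart b a) (spart c v) else 0.
  by apply: homog_spart; apply: sact_homog; apply: spart_homog.
rewrite -{1}(spartD a) -{1}(spartD v) !linearD /= !sactDl !linearD /= !H.
by case: e {H}; rewrite /= ?addr0 ?add0r // addrC.
Qed.

End ModuleFacts.

(** Homomorphisms of the underlying ungraded modules.  A homogeneous f of
    parity d is a superhomomorphism exactly when f \o twist d is unsigned, so
    the sign rule can be moved into [twist]. *)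
Section UnsignedHom.
Variables (R : comNzRingType) (A : superAlgType R).

Definition mhom (V W : superModType A) (f : V -> W) :=
  linear f /\ forall a v, f (sact a v) = sact a (f v).

Definition degree (V W : superModType A) (d : bool) (f : V -> W) :=
  forall b v, f (spart b v) = spart (b (+) d) (f v).

(** The component of f of parity d, written with projections only. *)
Definition hpart (V W : superModType A) d (f : V -> W) (v : V) : W :=
  spart d (f (spart false v)) + spart (~~ d) (f (spart true v)).

Section TwoModules.
Variables V W : superModType A.
Implicit Types f : V -> W.

Lemma hpart_degree d f : linear f -> degree d (hpart d f).
Proof.
move=> fl b v; rewrite /hpart !spartK !linearD /= !spartK.
by case: b; case: d; rewrite /= ?(lin0 fl) ?linear0 ?addr0 ?add0r.
Qed.

Lemma hpartD f v : linear f -> hpart false f v + hpart true f v = f v.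
Proof.
move=> fl; rewrite /hpart /= addrACA spartD addrC [X in X + _]addrC spartD.
by rewrite addrC -(linD fl) spartD.
Qed.

Lemma hpart_id d f : degree d f -> hpart d f =1 f.
Proof.
move=> fd v; rewrite /hpart !fd !spartK.
by case: d fd => fd; rewrite /= ?[spart true _ + _]addrC spartD.
Qed.

Lemma hpart_other d f v : degree d f -> hpart (~~ d) f v = 0.
Proof. by move=> fd; rewrite /hpart !fd !spartK; case: d fd; rewrite /= addr0. Qed.

Lemma hpart_linear d f : linear f -> linear (hpart d f).
Proof.
move=> fl; apply: lin_add; apply: lin_comp; try exact: spart_is_linear;
  by apply: lin_comp => //; apply: spart_is_linear.
Qed.

Lemma hpart_mhom d f : mhom f -> mhom (hpart d f).
Proof.
case=> fl fa; split; first exact: hpart_linear.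
move=> a v; rewrite /hpart !spart_sact !(linD fl) !fa !linearD /= !spart_sact.
rewrite !spartK /= !sact0l negbK !addr0 !add0r -[in RHS](spartD a) !sactDl.
by rewrite [X in _ + X]addrC addrACA [X in _ + X]addrC.
Qed.

Lemma homog_hom_degree d f : homog_hom d f -> degree d f.
Proof.
case=> fl fh _ b v; rewrite -[in RHS](spartD_neg b v) (linD fl) linearD /=.
rewrite (fh _ _ (spart_homog b v)) (homog_spart _ (fh _ _ (spart_homog (~~ b) v))).
by case: b; case: d fh; rewrite /= addr0.
Qed.

Lemma homog_hom_mhom d f : homog_hom d f -> mhom (f \o twist d).
Proof.
move=> fh; have fd := homog_hom_degree fh; case: fh => fl fh fa.
split; first exact: lin_comp (twist_linear _).
move=> a v /=.
have fa' b v' : f (sact (spart b a) v') =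
    (-1) ^+ (d && b) *: sact (spart b a) (f v')
    by apply: fa; apply: spart_homog.
case: d {fa fh} fd fa' => [|] fd fa'; last first.
  by rewrite -{1}(spartD a) sactDl (linD fl) !fa' !scale1r -sactDl spartD.
rewrite /twist !spart_sact !(linB fl) !(linD fl) !fa' /= expr0 expr1 !scale1r.
rewrite !scaleN1r -[in RHS](spartD a) !sactDl !linearB /=.
by rewrite opprK addrACA [X in _ + X]addrC.
Qed.

Lemma mhom_homog_hom d f : mhom f -> degree d f -> homog_hom d (f \o twist d).
Proof.
case=> fl fa fd; split.
- exact: lin_comp (twist_linear _).
- move=> b v hv; rewrite /homog /= (twist_homog _ hv) (linZ fl) linearZ /= -fd.
  by rewrite hv.
move=> b a v ha /=; case: d fd => [|] fd /=; last by rewrite expr0 scale1r.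
rewrite -fa -(linZ fl); congr f.
rewrite /twist !spart_sact !(homog_spart _ ha).
case: b ha => _ /=; rewrite !sact0l ?add0r ?addr0 linearB /= ?expr0 ?scale1r //.
by rewrite expr1 scaleN1r opprB.
Qed.

Lemma homog_hom0 d : homog_hom d (fun _ : V => 0 : W).
Proof.
split=> [a u v|b v _|b a v _]; rewrite ?scaler0 ?addr0 ?linear0 ?scaler0 //.
exact: linear0.
Qed.

Lemma homog_superhom d f : homog_hom d f -> superhom f.
Proof.
have h0 := homog_hom0; move=> fh; case: d fh => fh.
  by exists (fun=> 0), f; split => // v; rewrite add0r.
by exists f, (fun=> 0); split => // v; rewrite addr0.
Qed.

Lemma superhom_linear f : superhom f -> linear f.
Proof.
case=> f0 [f1 [[l0 _ _] [l1 _ _] e]] a u v.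
by rewrite !e l0 l1 scalerDr addrACA.
Qed.

End TwoModules.

(** After applying f to the sign rule for g, the signs of f and g cancel. *)
Lemma homog_hom_inv (V W : superModType A) d (f : V -> W) (g : W -> V) :
  homog_hom d f -> cancel f g -> cancel g f -> homog_hom d g.
Proof.
move=> fh fK gK; have fd := homog_hom_degree fh; case: fh => fl _ fa.
have fI := can_inj fK.
have gl : linear g by move=> a u v; apply: fI; rewrite fl !gK.
split=> // [b v hv|b a v ha].
  by rewrite /homog; apply: fI; rewrite fd -addbA addbb addbF gK.
apply: fI; rewrite gK (linZ fl) (fa b) // gK scalerA -exprD addnn -mul2n.
by rewrite exprM sqrrN !expr1n scale1r.
Qed.

Lemma siso_of_homog (V W : superModType A) d (f : V -> W) :
  homog_hom d f -> bijective f -> siso V W.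
Proof.
move=> fh [g fK gK]; exists f, g; split => //; first exact: homog_superhom fh.
exact: homog_superhom (homog_hom_inv fh fK gK).
Qed.

Lemma siso_sym (V W : superModType A) : siso V W -> siso W V.
Proof. by case=> f [g [? ? ? ?]]; exists g, f. Qed.

End UnsignedHom.

(** * Semisimple algebras: complements and derivations *)

Definition reg (R : comNzRingType) (A : superAlgType R) : Type := A.
HB.instance Definition _ (R : comNzRingType) (A : superAlgType R) :=
  SuperSpace.copy (reg A) A.
HB.instance Definition _ (R : comNzRingType) (A : superAlgType R) :=
  isSuperModule.Build R A (reg A) (@smul_linear_l R A) (@smul_linear_r R A)
    (fun a b v => esym (@smulA R A a b v)) (@smul1x R A) (@smul_homog R A).

Section Subspaces.
Variables (F : fieldType) (V : vectType F).
Implicit Types U W : {vspace V}.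

Lemma ex_max_dim (P : {vspace V} -> Prop) : (exists U, P U) ->
  exists2 U, P U & forall W, P W -> (\dim W <= \dim U)%N.
Proof.
move=> [U0 PU0]; pose p n := `[< exists2 U, P U & \dim U = n >].
have p0 : exists n, p n by exists (\dim U0); apply/asboolP; exists U0.
have pB n : p n -> (n <= \dim {:V})%N.
  by move=> /asboolP[U _ <-]; apply: dimvS; apply: subvf.
case: (ex_maxnP p0 pB) => n /asboolP[U PU <-] maxU.
by exists U => // W PW; apply: maxU; apply/asboolP; exists W.
Qed.

Lemma ex_min_dim (P : {vspace V} -> Prop) : (exists U, P U) ->
  exists2 U, P U & forall W, P W -> (\dim U <= \dim W)%N.
Proof.
move=> [U0 PU0]; pose p n := `[< exists2 U, P U & \dim U = n >].
have p0 : exists n, p n by exists (\dim U0); apply/asboolP; exists U0.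
case: (ex_minnP p0) => n /asboolP[U PU <-] minU.
by exists U => // W PW; apply: minU; apply/asboolP; exists W.
Qed.

(** A set closed under linear combinations is a subspace: a subspace of maximal
    dimension inside it contains every element. *)
Lemma vspace_of_set (S : set V) : S 0 ->
  (forall a u v, S u -> S v -> S (a *: u + v)) ->
  exists U, forall v, v \in U <-> S v.
Proof.
move=> S0 Sl; pose P U := forall v, v \in U -> S v.
have [|U PU maxU] := @ex_max_dim P.
  by exists 0%VS => v; rewrite memv0 => /eqP->.
exists U => v; split=> [/PU//|Sv].
suff PW : P (<[v]> + U)%VS.
  have /eqP -> : (U == <[v]> + U)%VS by rewrite eqEdim addvSr maxU.
  by rewrite (subvP (addvSl _ _)) ?memv_line.
by move=> _ /memv_addP[_ /vlineP[a ->] [u /PU Su ->]]; apply: Sl.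
Qed.

End Subspaces.

Section Semisimple.
Variables (F : fieldType) (B : superAlgType F).

Definition submod (X : superModType B) (W : {vspace X}) :=
  forall a v, v \in W -> sact a v \in W.

Lemma sact_scalar (X : superModType B) r (v : X) : sact (r *: sone : B) v = r *: v.
Proof. by rewrite sactZl sact1. Qed.

Lemma mhom_of_additive (X Y : superModType B) (f : X -> Y) :
  (forall a u v, f (sact a u + v) = sact a (f u) + f v) -> mhom f.
Proof.
move=> fP; have fl : linear f.
  by move=> r u v; rewrite -!sact_scalar fP.
by split=> // a v; have := fP a v 0; rewrite (lin0 fl) !addr0.
Qed.

Lemma submodD (X : superModType B) (U W : {vspace X}) :
  submod U -> submod W -> submod (U + W)%VS.
Proof.
move=> sU sW a _ /memv_addP[u uU [w wW ->]].
by rewrite linearD /= memv_add ?sU ?sW.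
Qed.

Lemma submod_cyclic (X : superModType B) (c : X) :
  exists2 W, submod W & forall v, v \in W <-> exists a : B, v = sact a c.
Proof.
have [||W WP] := @vspace_of_set _ X (fun v => exists a : B, v = sact a c).
- by exists 0; rewrite sact0l.
- by move=> r _ _ [a ->] [b ->]; exists (r *: a + b); rewrite sactDl sactZl.
by exists W => // a _ /WP[b ->]; apply/WP; exists (smul a b); rewrite sactA.
Qed.

Lemma submod_transporter (X : superModType B) (M : {vspace X}) (c : X) :
  submod M -> exists2 I : {vspace reg B}, submod I &
    forall b, b \in I <-> sact (b : B) c \in M.
Proof.
move=> sM; have [||I IP] := @vspace_of_set _ (reg B) (fun b => sact (b : B) c \in M).
- by rewrite sact0l mem0v.
- by move=> r a b aM bM; rewrite sactDl sactZl rpredD // rpredZ.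
exists I => // a b /IP bM; apply/IP.
by rewrite [sact a b]/(smul a b) sactA sM.
Qed.

Lemma maximal_cover (I : set B) (z : B) : maximal_left_ideal I -> ~ I z ->
  forall n, exists i b, I i /\ n = i + smul b z.
Proof.
move=> [[I0 ID IM] IT maxI] Iz n.
pose J : set B := fun x => exists i b, I i /\ x = i + smul b z.
have JT : J = setT.
  have lJ : left_ideal J.
    split.
    - by exists 0, 0; split; rewrite ?(lin0 (smul_linear_l z)) ?addr0.
    - move=> _ _ [i [b [hi ->]]] [i' [b' [hi' ->]]]; exists (i + i'), (b + b').
      by split; [apply: ID | rewrite (linD (smul_linear_l z)) addrACA].
    move=> a _ [i [b [hi ->]]]; exists (smul a i), (smul a b).
    by split; [apply: IM | rewrite (linD (smul_linear_r a)) smulA].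
  have IJ : (I `<=` J)%classic.
    by move=> i hi; exists i, 0; rewrite (lin0 (smul_linear_l z)) addr0.
  case: (maxI J lJ IJ) => // JI; case: Iz; rewrite -JI.
  by exists 0, sone; rewrite smul1x add0r.
by have : J n by rewrite JT.
Qed.

Hypothesis ssB : semisimple B.

Lemma radical_avoid (z : B) : z <> 0 ->
  exists2 I, maximal_left_ideal I & ~ I z.
Proof.
move=> z0; apply: contrapT => H; apply: z0.
have : jacobson_radical z by move=> I mI; apply: contrapT => Iz; apply: H; exists I.
by rewrite ssB.
Qed.

(** A minimal left ideal N outside I meets I trivially: for z <> 0 in N :&: I
    pick a maximal left ideal I' avoiding z; then N :&: I' lies in I by
    minimality, and N = (N :&: I') + B z lies in I as well. *)
Lemma left_ideal_avoid (I : {vspace reg B}) : submod I -> sone \notin I ->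
  exists N : {vspace reg B},
    [/\ submod N, exists2 n, n \in N & n \notin I
      & forall b, b \in N -> b \in I -> b = 0].
Proof.
move=> sI I1.
pose P (N : {vspace reg B}) := submod N /\ ~~ (N <= I)%VS.
have [|N [sN NI] minN] := @ex_min_dim _ (reg B) P.
  exists fullv; split=> [a v _|]; first exact: memvf.
  by apply/subvPn; exists sone; rewrite ?memvf.
have [n nN nI] := subvPn NI.
exists N; split=> // [|z zN zI]; first by exists n.
apply: contrapT => /radical_avoid[I' mI' I'z].
have [[I'0 I'D I'M] _ _] := mI'.
have I'Z r (x : B) : I' x -> I' (r *: x).
  by move=> /(I'M (r *: sone)); rewrite (linZ (smul_linear_l x)) smul1x.
have [|W WP] := @vspace_of_set _ (reg B) I' I'0.
  by move=> r u v Iu Iv; apply: I'D => //; apply: I'Z.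
have NWI : (N :&: W <= I)%VS.
  apply: contraPT zN => NWI zN.
  have PNW : P (N :&: W)%VS.
    split=> // a v /memv_capP[vN /WP vI']; apply/memv_capP; split; first exact: sN.
    by apply/WP; apply: I'M.
  have /eqP NW : (N :&: W == N)%VS by rewrite eqEdim capvSl minN.
  by apply: I'z; apply/WP; move: zN; rewrite -{1}NW => /memv_capP[].
have [i [b [Ii nE]]] := maximal_cover mI' I'z n.
case/negP: nI; rewrite nE; apply: memvD; last exact: (sI b).
apply: (subvP NWI); apply/memv_capP; split; last exact/WP.
have -> : i = n - sact b (z : reg B) by rewrite nE addrK.
by apply: memvB => //; apply: sN.
Qed.

(** Dual bases relative to a pair of submodules U <= W: together the i_j and
    x_j give a projection of W with kernel U.  The induction peels off simple
    quotients of W, each of which embeds into B by [left_ideal_avoid]. *)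
Lemma relative_dual_basis (X : superModType B) (U W : {vspace X}) :
  submod U -> submod W -> (U <= W)%VS ->
  exists (n : nat) (i : nat -> X -> reg B) (x : nat -> X),
    [/\ forall j a u v, u \in W -> v \in W ->
          i j (sact a u + v) = sact a (i j u) + i j v,
        forall j u, u \in U -> i j u = 0
      & forall v, v \in W ->
          v - \sum_(0 <= j < n) sact (i j v : B) (x j) \in U].
Proof.
move=> sU; have [k] := ubnP (\dim W); elim: k W => // k IH W /ltnSE Wk sW UW.
have [WU|WU] := boolP (W <= U)%VS.
  exists 0, (fun _ _ => 0), (fun _ => 0); split=> // [j a u v _ _|v vW].
    by rewrite linear0 addr0.
  by rewrite big_nil subr0; apply: (subvP WU).
pose P M := [/\ submod M, (U <= M)%VS, (M <= W)%VS & M <> W].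
have [|M [sM UM MW nMW] maxM] := @ex_max_dim _ X P.
  by exists U; split=> // e; rewrite e subvv in WU.
have [c cW cM] : exists2 c, c \in W & c \notin M.
  by apply/subvPn; apply/negP => WM; apply: nMW; apply: subv_anti; rewrite MW.
have [I sI IP] := submod_transporter c sM.
have I1 : sone \notin I by apply/negP => /IP; rewrite sact1; apply/negP.
have [N [sN [n nN nI] NI]] := left_ideal_avoid sI I1.
have [C sC CP] := submod_cyclic (sact (n : B) c).
(* W / M is simple and generated by n c, with n in the ideal N meeting I
   trivially; so each v in W is m + b c for a unique b in N. *)
have MCW : (M + C)%VS = W.
  apply: contrapT => ne; have PM : P (M + C)%VS.
    split=> //; first exact: submodD.
      exact: subv_trans UM (addvSl _ _).
    rewrite subv_add MW /=; apply/subvP => _ /CP[a ->].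
    by apply: (sW); apply: (sW).
  have /eqP e : (M == M + C)%VS by rewrite eqEdim addvSl maxM.
  case/negP: nI; apply/IP; rewrite e -[sact _ _]add0r memv_add ?mem0v //.
  by apply/CP; exists sone; rewrite sact1.
have uniq b b' v : b \in N -> b' \in N -> v - sact (b : B) c \in M ->
    v - sact (b' : B) c \in M -> b = b'.
  move=> bN b'N bM b'M; apply/eqP; rewrite -subr_eq0; apply/eqP.
  apply: NI; first exact: memvB.
  apply/IP; have := memvB b'M bM.
  by rewrite opprB addrC addrA subrK sactBl.
have /choice[i0 i0P] : forall v, exists b : reg B,
    v \in W -> b \in N /\ v - sact (b : B) c \in M.
  move=> v; have [vW|vW] := boolP (v \in W); last by exists 0.
  move: vW; rewrite -{1}MCW => /memv_addP[m mM [_ /CP[a ->] ->]].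
  exists (sact a n) => _; split; first exact: sN.
  by rewrite [sact a n]/(smul a (n : B)) sactA addrK.
have i0lin a u v : u \in W -> v \in W ->
    i0 (sact a u + v) = sact a (i0 u) + i0 v.
  move=> uW vW; have [[uN uM] [vN vM]] := (i0P u uW, i0P v vW).
  have [N' M'] := i0P (sact a u + v) (memvD (sW a u uW) vW).
  apply: (uniq _ _ _ N' _ M'); first by apply: memvD => //; apply: sN.
  rewrite sactDl [sact a (i0 u)]/(smul a (i0 u : B)) sactA opprD addrACA -linearB.
  by apply: memvD => //; apply: sM.
have i0M u : u \in M -> i0 u = 0.
  move=> uM; have [N' M'] := i0P u (subvP MW _ uM).
  by apply: (uniq _ _ _ N' _ M'); rewrite ?mem0v // sact0l subr0.
have [|n' [i [x [ilin iU ix]]]] := IH M _ sM UM.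
  apply: leq_trans Wk; rewrite ltn_neqAle dimvS // andbT.
  apply/eqP => e; apply: nMW; apply/eqP; rewrite eqEdim MW e /=.
  by [].
pose q v := v - sact (i0 v : B) c.
have qM v : v \in W -> q v \in M by move=> /i0P[].
exists n'.+1, (fun j v => if j is j'.+1 then i j' (q v) else i0 v),
  (fun j => if j is j'.+1 then x j' else c); split.
- move=> [|j] a u v uW vW; first exact: i0lin.
  rewrite -ilin ?qM // /q i0lin // sactDl.
  rewrite [sact a (i0 u)]/(smul a (i0 u : B)) sactA opprD addrACA.
  by rewrite -linearB.
- move=> [|j] u uU; first by apply: i0M; apply: (subvP UM).
  by rewrite iU // /q i0M ?sact0l ?subr0 //; apply: (subvP UM).
by move=> v vW; rewrite big_nat_recl //= opprD addrA; apply: ix; apply: qM.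
Qed.

Lemma dual_basis (X : superModType B) (U : {vspace X}) : submod U ->
  exists (n : nat) (i : nat -> X -> reg B) (x : nat -> X),
    [/\ forall j, mhom (i j), forall j u, u \in U -> i j u = 0
      & forall v, v - \sum_(0 <= j < n) sact (i j v : B) (x j) \in U].
Proof.
move=> sU; have sT : submod (fullv : {vspace X}) by move=> *; apply: memvf.
have [n [i [x [il iU ix]]]] := relative_dual_basis sU sT (subvf U).
exists n, i, x; split=> // [j|v]; last by apply: ix; apply: memvf.
by apply: mhom_of_additive => a u v; rewrite il ?memvf.
Qed.

(** First Hochschild cohomology vanishes: with a dual basis v = sum i_j(v) x_j,
    the derivation D is the inner derivation of v |-> sum D(i_j(v)) x_j. *)
Lemma derivation_inner (X Y : superModType B) (D : B -> X -> Y) :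
  (forall v, linear (D^~ v)) -> (forall a, linear (D a)) ->
  (forall a b v, D (smul a b) v = sact a (D b v) + D a (sact b v)) ->
  exists2 f : X -> Y, linear f & forall a v, D a v = f (sact a v) - sact a (f v).
Proof.
move=> Dl Dr DM.
have s0 : submod (0%VS : {vspace X}).
  by move=> a v; rewrite !memv0 => /eqP->; rewrite linear0.
have [n [i [x [ih _ ix]]]] := dual_basis s0.
exists (fun v => \sum_(0 <= j < n) D (i j v) (x j)) => [|a v].
  by apply: lin_bigsum => j; apply: (lin_comp (Dl _)); case: (ih j).
have {1}-> : v = \sum_(0 <= j < n) sact (i j v : B) (x j).
  by apply/eqP; rewrite -subr_eq0 -memv0; apply: ix.
rewrite (lin_sum (Dr a)) linear_sum /= -sumrB; apply: eq_bigr => j _.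
by case: (ih j) => _ ->; rewrite [sact a (i j v)]/(smul a (i j v : B)) DM [X in X - _]addrC addrK.
Qed.

(** Complete reducibility: such an e is idempotent with kernel U. *)
Lemma projection_along (X : superModType B) (U : {vspace X}) : submod U ->
  exists e : X -> X, [/\ mhom e, forall u, u \in U -> e u = 0
    & forall v, v - e v \in U].
Proof.
move=> sU; have [n [i [x [ih iU ix]]]] := dual_basis sU.
exists (fun v => \sum_(0 <= j < n) sact (i j v : B) (x j)); split=> //; last first.
  by move=> u uU; rewrite big1 // => j _; rewrite iU // sact0l.
split=> [|a v].
  by apply: lin_bigsum => j; apply: (lin_comp (sact_linear_l _)); case: (ih j).
rewrite linear_sum; apply: eq_bigr => j _ /=; case: (ih j) => _ ->.
by rewrite [sact a (i j v)]/(smul a (i j v : B)) sactA.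
Qed.

End Semisimple.

(** * Ranks of matrices over a domain under two specialisations *)

Lemma mxvec_linE (R : comNzRingType) m1 n1 m2 n2 (f : 'M[R]_(m1, n1) -> 'M_(m2, n2))
    (A : 'M_(m1, n1)) :
  linear f -> mxvec A *m lin_mx f = mxvec (f A).
Proof.
move=> fl.
pose L : {linear 'M[R]_(m1, n1) -> 'M[R]_(m2, n2)} :=
  HB.pack f (GRing.isLinear.Build _ _ _ _ f fl).
exact: (mul_vec_lin L).
Qed.

Lemma eq_mulmx_row (R : comNzRingType) m n (P Q : 'M[R]_(m, n)) :
  (forall u : 'rV_m, u *m P = u *m Q) -> P = Q.
Proof. by move=> H; apply/row_matrixP => i; rewrite !rowE. Qed.

Section Specialisation.
Variables (O : comNzRingType) (K k : fieldType).
Variables (iota : {rmorphism O -> K}) (res : {rmorphism O -> k}).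
Hypothesis iota_inj : injective iota.

(** A minor that is nonzero after [res] is nonzero in O, hence after [iota]. *)
Lemma rank_specialise m n (C : 'M[O]_(m, n)) :
  (\rank (map_mx res C) <= \rank (map_mx iota C))%N.
Proof.
set A := map_mx res C.
pose f := maxrankfun A; pose R1 := rowsub f A.
have rR1 : \rank R1 = \rank A by apply/eqP; apply: maxrowsub_free.
pose g := maxrankfun R1^T.
have rR2 : row_free (rowsub g R1^T) by apply: maxrowsub_free.
have e : \rank R1^T = \rank A by rewrite mxrank_tr.
have : mxsub g f A^T = rowsub g R1^T by apply/matrixP => i j; rewrite !mxE.
move: g rR2; rewrite e => g rR2 gE.
have dA : \det (mxsub f g A) != 0.
  rewrite -det_tr -unitfE -unitmxE -row_free_unit.
  by have -> : (mxsub f g A)^T = rowsub g R1^T by apply/matrixP => i j; rewrite !mxE.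
have dC : \det (mxsub f g C) != 0.
  apply: contraNneq dA => dC0; have : mxsub f g A = map_mx res (mxsub f g C).
    by apply/matrixP => i j; rewrite !mxE.
  by move=> ->; rewrite det_map_mx dC0 rmorph0.
have uC : mxsub f g (map_mx iota C) \in unitmx.
  have -> : mxsub f g (map_mx iota C) = map_mx iota (mxsub f g C).
    by apply/matrixP => i j; rewrite !mxE.
  by rewrite unitmxE unitfE det_map_mx -(rmorph0 iota) (inj_eq iota_inj).
rewrite -[X in (X <= _)%N](mxrank_unit uC).
have -> : mxsub f g (map_mx iota C) = rowsub f (colsub g (map_mx iota C)).
  by apply/matrixP => i j; rewrite !mxE.
apply: leq_trans (mxrankS (rowsub_sub _ _)) _.
rewrite -mxrank_tr -[X in (_ <= X)%N]mxrank_tr.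
have -> : (colsub g (map_mx iota C))^T = rowsub g (map_mx iota C)^T.
  by apply/matrixP => i j; rewrite !mxE.
exact: mxrankS (rowsub_sub _ _).
Qed.

(** In a complex C0, C1 which becomes exact after [res] both ranks can only grow
    when passing to [iota], while their sum is bounded by the middle dimension. *)
Lemma rank_exact m n p (C0 : 'M[O]_(m, n)) (C1 : 'M[O]_(n, p)) :
  C0 *m C1 = 0 -> (kermx (map_mx res C1) <= map_mx res C0)%MS ->
  \rank (map_mx iota C0) = \rank (map_mx res C0).
Proof.
move=> C01 ex; apply/eqP; rewrite eqn_leq rank_specialise andbT.
have H : (\rank (map_mx iota C0) + \rank (map_mx iota C1) <= n)%N.
  by apply: mulmx0_rank_max; rewrite -map_mxM C01 map_mx0.
have := mxrankS ex; rewrite mxrank_ker leq_subLR addnC => H'.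
have := leq_trans H H'; have := rank_specialise C1.
move=> r1 /(leq_trans _) -/(_ _ (leq_add (leqnn _) r1)) => {}H'.
by rewrite leq_add2r in H'.
Qed.

End Specialisation.

(** * The derivation complex in coordinates *)

(** An algebra with structure constants S (row j of S i holds the coordinates of
    the product of basis elements i and j) acts on row vectors on the right, by
    the matrices RM and RN.  [cobound0] sends a matrix X to its inner derivation,
    and [cobound1] sends D, whose row i is the value at basis element i, to the
    failure of the Leibniz rule. *)
Section Complex.
Variables (R : comNzRingType) (r m n : nat).
Variables (S : 'I_r -> 'M[R]_r) (RM : 'I_r -> 'M[R]_m) (RN : 'I_r -> 'M[R]_n).

Definition cobound0 (X : 'M[R]_(m, n)) : 'M[R]_(r, m * n) :=
  \matrix_i mxvec (RM i *m X - X *m RN i).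

Definition leibniz (D : 'M[R]_(r, m * n)) i j : 'M[R]_(m, n) :=
  vec_mx (row j (S i) *m D) - vec_mx (row j D) *m RN i - RM j *m vec_mx (row i D).

Definition cobound1 (D : 'M[R]_(r, m * n)) : 'M[R]_(r, r * (m * n)) :=
  \matrix_i mxvec (\matrix_j mxvec (leibniz D i j)).

Let lin_rows p q (V : lmodType R) (f : 'I_p -> V -> 'rV[R]_q) :
  (forall i, linear (f i)) -> linear (fun X => \matrix_i f i X).
Proof. by move=> fl a X Y; apply/row_matrixP => i; rewrite [RHS]linearP /= !rowK fl. Qed.

Lemma lin_mulmx p q s (A : 'M[R]_(p, q)) : linear (fun X : 'M_(q, s) => A *m X).
Proof. exact: (linearP (mulmx A)). Qed.

Lemma lin_mulmxr p q s (A : 'M[R]_(q, s)) : linear (fun X : 'M_(p, q) => X *m A).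
Proof. exact: (linearP (mulmxr A)). Qed.

Let lin_vec : linear (@vec_mx R m n). Proof. exact: linearP. Qed.
Let lin_mxvec p q : linear (@mxvec R p q). Proof. exact: linearP. Qed.
Let lin_row p q i : linear (@row R p q i). Proof. exact: linearP. Qed.

Lemma cobound0_linear : linear cobound0.
Proof.
apply: lin_rows => i; apply: lin_comp; first exact: lin_mxvec.
apply: lin_add; first exact: lin_mulmx.
by apply: lin_opp; apply: lin_mulmxr.
Qed.

Lemma leibniz_linear i j : linear (fun D => leibniz D i j).
Proof.
have rowvec l : linear (fun D : 'M[R]_(r, m * n) => vec_mx (row l D)).
  by apply: lin_comp; [exact: lin_vec|exact: lin_row].
rewrite /leibniz; apply: lin_add; first apply: lin_add.
- have row_mul : linear (fun D : 'M[R]_(r, m * n) => row j (S i) *m D).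
    exact: lin_mulmx.
  exact: (lin_comp lin_vec row_mul).
- by apply: lin_opp; exact: (lin_comp (lin_mulmxr (RN i)) (rowvec j)).
by apply: lin_opp; exact: (lin_comp (lin_mulmx (RM j)) (rowvec i)).
Qed.

Lemma cobound1_linear : linear cobound1.
Proof.
apply: lin_rows => i; apply: lin_comp; first exact: lin_mxvec.
apply: lin_rows => j; apply: lin_comp; first exact: lin_mxvec.
exact: leibniz_linear.
Qed.

Lemma cobound0_eq0 X : cobound0 X = 0 <-> forall i, RM i *m X = X *m RN i.
Proof.
split=> [X0 i|H].
  apply/eqP; rewrite -subr_eq0; apply/eqP; apply: (can_inj mxvecK).
  by rewrite -(rowK (fun i => mxvec (RM i *m X - X *m RN i))) -/(cobound0 X) X0 row0 linear0.
by apply/row_matrixP => i; rewrite rowK H subrr linear0 row0.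
Qed.

Lemma cobound1_eq0 D : cobound1 D = 0 <-> forall i j, leibniz D i j = 0.
Proof.
split=> [D0 i j|H].
  apply: (can_inj mxvecK); rewrite linear0.
  rewrite -(rowK (fun j => mxvec (leibniz D i j))) -[\matrix_j _]mxvecK.
  rewrite -(rowK (fun i => mxvec (\matrix_j mxvec (leibniz D i j)))).
  by rewrite -/(cobound1 D) D0 row0 linear0 row0.
apply/row_matrixP => i; rewrite rowK row0; apply: (can_inj vec_mxK).
by rewrite mxvecK linear0; apply/row_matrixP => j; rewrite rowK H linear0 row0.
Qed.

Hypothesis RM_mul : forall i j, \sum_c S i j c *: RM c = RM j *m RM i.
Hypothesis RN_mul : forall i j, \sum_c S i j c *: RN c = RN j *m RN i.

Lemma cobound10 X : cobound1 (cobound0 X) = 0.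
Proof.
apply/cobound1_eq0 => i j; rewrite /leibniz !rowK !mxvecK.
have -> : vec_mx (row j (S i) *m cobound0 X) = RM j *m RM i *m X - X *m (RN j *m RN i).
  rewrite -RM_mul -RN_mul mulmx_suml mulmx_sumr -sumrB mulmx_sum_row linear_sum.
  apply: eq_bigr => c _; rewrite linearZ /= rowK mxvecK mxE scalerBr.
  by rewrite scalemxAl scalemxAr.
rewrite !mulmxBl !mulmxBr !mulmxA !opprB.
by rewrite !subrKA subrr.
Qed.

Lemma lin_mx_cobound10 : lin_mx cobound0 *m lin_mx cobound1 = 0.
Proof.
apply: eq_mulmx_row => u; rewrite mulmx0 mulmxA -[u]vec_mxK.
rewrite (mxvec_linE _ cobound0_linear) (mxvec_linE _ cobound1_linear).
by rewrite cobound10 linear0.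
Qed.

End Complex.

Section MapComplex.
Variables (O F : comNzRingType) (phi : {rmorphism O -> F}) (r m n : nat).
Variables (S : 'I_r -> 'M[O]_r) (RM : 'I_r -> 'M[O]_m) (RN : 'I_r -> 'M[O]_n).
Local Notation "M ^p" := (fun i => map_mx phi (M i)) (at level 2).

Lemma map_cobound0 : map_mx phi (lin_mx (cobound0 RM RN)) =
  lin_mx (cobound0 RM^p RN^p).
Proof.
apply: map_lin_mx => X; apply/row_matrixP => i.
by rewrite -map_row !rowK map_mxvec map_mxB !map_mxM.
Qed.

Lemma map_cobound1 : map_mx phi (lin_mx (cobound1 S RM RN)) =
  lin_mx (cobound1 S^p RM^p RN^p).
Proof.
apply: map_lin_mx => D; apply/row_matrixP => i.
rewrite -map_row !rowK map_mxvec; congr mxvec; apply/row_matrixP => j.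
rewrite -map_row !rowK map_mxvec /leibniz !map_mxB !map_mxM !map_vec_mx.
by rewrite map_mxM !map_row.
Qed.

End MapComplex.

(** * Coordinates on extensions of scalars *)

(** The matrix form of [hpart]: E and G are the grading projections. *)
Definition mpart (R : comNzRingType) m n (E : bool -> 'M[R]_m) (G : bool -> 'M[R]_n)
    d (X : 'M[R]_(m, n)) :=
  E false *m X *m G d + E true *m X *m G (~~ d).

Lemma mpart_linear (R : comNzRingType) m n (E : bool -> 'M[R]_m)
  (G : bool -> 'M[R]_n) d : linear (mpart E G d).
Proof.
have H b c : linear (fun X => E b *m X *m G c).
  exact: (lin_comp (lin_mulmxr (G c)) (lin_mulmx (E b))).
exact: lin_add.
Qed.

Section Coordinates.
Variables (O F : comNzRingType) (phi : {rmorphism O -> F}).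

Section Vect.
Variable M : vectType O.

Definition ecoor (x : ext phi M) : 'rV[F]_(dim M) :=
  ext_lift (fun v => map_mx phi (v2r v)) x.
Definition ebasis i : ext phi M := tens1 phi (r2v (delta_mx 0 i)).
Definition edecode (c : 'rV[F]_(dim M)) : ext phi M := \sum_i c 0 i *: ebasis i.

Let coor_semilin : semilin phi (fun v : M => map_mx phi (v2r v)).
Proof. by move=> a u v; rewrite linearP map_mxD map_mxZ. Qed.

Lemma ecoor_linear : linear ecoor.
Proof. exact: ext_lift_linear. Qed.

Lemma ecoor_tens1 v : ecoor (tens1 phi v) = map_mx phi (v2r v).
Proof. exact: ext_lift_tens1. Qed.

Lemma edecode_linear : linear edecode.
Proof.
move=> a u v; rewrite /edecode scaler_sumr -big_split; apply: eq_bigr => i _ /=.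
by rewrite !mxE scalerDl scalerA.
Qed.

Lemma tens1_coor v :
  tens1 phi v = \sum_i (phi (v2r v 0 i)) *: ebasis i.
Proof.
pose T : {linear M -> ext phi M | phi \; *:%R} :=
  HB.pack (@tens1 _ _ phi M)
    (GRing.isLinear.Build _ _ _ _ (@tens1 _ _ phi M) (@tens1_semilin _ _ phi M)).
rewrite -[tens1 phi v]/(T v) -{1}[v]v2rK {1}[v2r v]row_sum_delta !linear_sum.
by apply: eq_bigr => i _; rewrite !linearZ.
Qed.

Lemma ecoorK : cancel ecoor edecode.
Proof.
apply: ext_linear_eq => // [a x y|v].
  by rewrite ecoor_linear edecode_linear.
by rewrite ecoor_tens1 tens1_coor /edecode; apply: eq_bigr => i _; rewrite mxE.
Qed.

Lemma ecoor_basis i : ecoor (ebasis i) = delta_mx 0 i.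
Proof. by rewrite ecoor_tens1 r2vK map_delta_mx. Qed.

Lemma edecodeK : cancel edecode ecoor.
Proof.
move=> c; rewrite /edecode (lin_sum ecoor_linear) [RHS]row_sum_delta.
by apply: eq_bigr => i _; rewrite (linZ ecoor_linear) ecoor_basis.
Qed.

Lemma ext_basis_eq (W : lmodType F) (f g : ext phi M -> W) :
  linear f -> linear g -> (forall i, f (ebasis i) = g (ebasis i)) -> f =1 g.
Proof.
move=> fl gl fg x; rewrite -[x]ecoorK /edecode (lin_sum fl) (lin_sum gl).
by apply: eq_bigr => i _; rewrite (linZ fl) (linZ gl) fg.
Qed.

End Vect.

Section Matrices.
Variables M N : vectType O.

(** Matrices act on row vectors of coordinates on the right. *)
Definition emx (f : ext phi M -> ext phi N) : 'M[F]_(dim M, dim N) :=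
  \matrix_i ecoor (f (@ebasis M i)).
Definition efun (X : 'M[F]_(dim M, dim N)) (x : ext phi M) : ext phi N :=
  edecode (ecoor x *m X).

Lemma emxP f x : linear f -> ecoor (f x) = ecoor x *m emx f.
Proof.
move=> fl; rewrite -{1}[x]ecoorK /edecode (lin_sum fl) mulmx_sum_row.
rewrite (lin_sum (@ecoor_linear N)); apply: eq_bigr => i _.
by rewrite (linZ fl) (linZ (@ecoor_linear N)) rowK.
Qed.

Lemma efun_linear X : linear (efun X).
Proof.
by move=> a u v; rewrite /efun ecoor_linear mulmxDl -scalemxAl edecode_linear.
Qed.

Lemma ecoor_efun X x : ecoor (efun X x) = ecoor x *m X.
Proof. exact: edecodeK. Qed.

Lemma emx_unique f X : (forall x, ecoor (f x) = ecoor x *m X) -> emx f = X.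
Proof.
by move=> H; apply/row_matrixP => i; rewrite rowK H ecoor_basis rowE.
Qed.

Lemma efunK X : emx (efun X) = X.
Proof. by apply: emx_unique => x; apply: ecoor_efun. Qed.

Lemma emxK f : linear f -> efun (emx f) =1 f.
Proof. by move=> fl x; rewrite /efun -emxP // ecoorK. Qed.

End Matrices.

Section Modules.
Variable A : superAlgType O.

Section OneModule.
Variable M : superModType A.

Definition actmx (a : A) : 'M[O]_(dim M) := lin1_mx (v2r \o sact a \o r2v).
Definition partmx b : 'M[O]_(dim M) := lin1_mx (v2r \o @spart O M b \o r2v).

Lemma v2r_sact a v : v2r (sact a v) = v2r v *m actmx a.
Proof. by rewrite mul_rV_lin1 /= v2rK. Qed.

Lemma v2r_spart b v : v2r (spart b v) = v2r v *m partmx b.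
Proof. by rewrite mul_rV_lin1 /= v2rK. Qed.

Lemma actmx_linear : linear actmx.
Proof.
move=> r a b; apply: eq_mulmx_row => u; rewrite -[u]r2vK -v2r_sact.
by rewrite sact_linear_l linearP /= mulmxDr -scalemxAr -!v2r_sact.
Qed.

Lemma actmx_mul a b : actmx (smul a b) = actmx b *m actmx a.
Proof.
by apply: eq_mulmx_row => u; rewrite -[u]r2vK mulmxA -!v2r_sact sactA.
Qed.

Lemma sact_tens1 a (v : M) :
  sact (tens1 phi a) (tens1 phi v) = tens1 phi (sact a v) :> ext phi M.
Proof.
exact: (ext_bil_tens1 _ (@sact_linear_l _ _ M) (@sact_linear_r _ _ M)).
Qed.

Lemma spart_tens1 b (v : M) :
  spart b (tens1 phi v) = tens1 phi (spart b v) :> ext phi M.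
Proof. exact: ext_spart_tens1. Qed.

Lemma ecoor_sact a (x : ext phi M) :
  ecoor (sact (tens1 phi a) x) = ecoor x *m map_mx phi (actmx a).
Proof.
move: x; apply: ext_linear_eq => [r x y|r x y|v].
- by rewrite linearP ecoor_linear.
- by rewrite ecoor_linear mulmxDl scalemxAl.
by rewrite sact_tens1 !ecoor_tens1 v2r_sact map_mxM.
Qed.

Lemma ecoor_spart b (x : ext phi M) :
  ecoor (spart b x) = ecoor x *m map_mx phi (partmx b).
Proof.
move: x; apply: ext_linear_eq => [r x y|r x y|v].
- by rewrite linearP ecoor_linear.
- by rewrite ecoor_linear mulmxDl scalemxAl.
by rewrite spart_tens1 !ecoor_tens1 v2r_spart map_mxM.
Qed.

End OneModule.

Definition abasis i : A := r2v (delta_mx 0 i).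

Section TwoModules.
Variables M N : superModType A.

Lemma mhom_emx (f : ext phi M -> ext phi N) : linear f ->
  mhom f <-> forall i, map_mx phi (actmx M (abasis i)) *m emx f =
                       emx f *m map_mx phi (actmx N (abasis i)).
Proof.
move=> fl; split=> [[_ fa] i|H].
  apply: eq_mulmx_row => u; rewrite -[u]edecodeK !mulmxA -ecoor_sact.
  by rewrite -!emxP // fa ecoor_sact.
split=> // a v; move: a; apply: ext_basis_eq => [r a b|r a b|i].
- by rewrite sact_linear_l fl.
- by rewrite sact_linear_l.
apply: (can_inj (@ecoorK N)); rewrite emxP // !ecoor_sact -mulmxA H mulmxA.
by rewrite emxP.
Qed.

Lemma emx_hpart d (f : ext phi M -> ext phi N) : linear f ->
  emx (hpart d f) = mpart (fun b => map_mx phi (partmx M b))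
                          (fun b => map_mx phi (partmx N b)) d (emx f).
Proof.
move=> fl; apply: emx_unique => x.
rewrite /hpart (linD (@ecoor_linear N)) !ecoor_spart !(emxP _ fl) !ecoor_spart.
by rewrite mulmxDr !mulmxA.
Qed.

End TwoModules.

End Modules.

End Coordinates.

(** * Homomorphism spaces over the fraction field and the residue field *)

Section HomMatrices.
Variables (O : comNzRingType) (A : superAlgType O) (M N : superModType A).

(** The kernel of [hom_mx] is the space of unsigned homomorphisms from M to N,
    that of [hom_deg_mx d] the space of those of parity d; both over O and, after
    base change, over any O-algebra. *)
Definition struct_mx (i : 'I_(dim A)) : 'M[O]_(dim A) := actmx (reg A) (abasis i).
Definition hom_mx :=
  lin_mx (cobound0 (fun i => actmx M (abasis i)) (fun i => actmx N (abasis i))).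
Definition der_mx :=
  lin_mx (cobound1 struct_mx (fun i => actmx M (abasis i))
                   (fun i => actmx N (abasis i))).
Definition part_mx d := lin_mx (mpart (partmx M) (partmx N) d).
Definition hom_deg_mx d := row_mx hom_mx (part_mx (~~ d)).

Lemma struct_mx_act (W : superModType A) i j :
  \sum_c struct_mx i j c *: actmx W (abasis c) =
  actmx W (abasis j) *m actmx W (abasis i).
Proof.
rewrite -actmx_mul.
have -> : smul (abasis i) (abasis j) = \sum_c struct_mx i j c *: abasis c :> A.
  apply: (can_inj (@v2rK _ A)); rewrite linear_sum [LHS]row_sum_delta.
  apply: eq_bigr => c _; rewrite linearZ /= r2vK; congr (_ *: _).
  have := v2r_sact (abasis i) (abasis j : reg A).
  by rewrite [v2r (abasis j : reg A)]r2vK -rowE => /rowP/(_ c); rewrite mxE.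
rewrite (lin_sum (@actmx_linear _ _ W)); apply: eq_bigr => c _.
by rewrite (linZ (@actmx_linear _ _ W)).
Qed.

Lemma hom_der_mx : hom_mx *m der_mx = 0.
Proof. by apply: lin_mx_cobound10 => i j; apply: struct_mx_act. Qed.

Section Base.
Variables (F : comNzRingType) (phi : {rmorphism O -> F}).
Implicit Types u : 'rV[F]_(dim M * dim N).

Definition hom_of u : ext phi M -> ext phi N := efun (vec_mx u).

Lemma hom_of_linear u : linear (hom_of u).
Proof. exact: efun_linear. Qed.

Lemma emx_hom_of u : mxvec (emx (hom_of u)) = u.
Proof. by rewrite efunK vec_mxK. Qed.

Lemma hom_of_emx f : linear f -> hom_of (mxvec (emx f)) =1 f.
Proof. by move=> fl x; rewrite /hom_of mxvecK emxK. Qed.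

Lemma hom_mxP u : u *m map_mx phi hom_mx = 0 <-> mhom (hom_of u).
Proof.
rewrite (mhom_emx (hom_of_linear u)) -cobound0_eq0.
rewrite map_cobound0 -{1}(emx_hom_of u) (mxvec_linE _ (@cobound0_linear _ _ _ _ _ _)).
by split=> [/(canRL mxvecK)->|->]; rewrite linear0.
Qed.

Lemma part_mxP d u :
  u *m map_mx phi (part_mx d) = mxvec (emx (hpart d (hom_of u))).
Proof.
rewrite emx_hpart; last exact: hom_of_linear.
have -> : map_mx phi (part_mx d) = lin_mx (mpart (fun b => map_mx phi (partmx M b))
                          (fun b => map_mx phi (partmx N b)) d).
  by apply: map_lin_mx => X; rewrite map_mxD !map_mxM.
by rewrite -{1}(emx_hom_of u) (mxvec_linE _ (@mpart_linear _ _ _ _ _ _)).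
Qed.

Lemma hom_deg_mxP d u : u *m map_mx phi (hom_deg_mx d) = 0 <->
  mhom (hom_of u) /\ degree d (hom_of u).
Proof.
rewrite map_row_mx mul_mx_row -hom_mxP part_mxP.
have hl := hom_of_linear u.
split=> [/eqP|[-> hd]].
  rewrite row_mx_eq0 => /andP[/eqP -> /eqP/(canRL mxvecK)]; rewrite linear0 => e.
  split=> // b v; have fE w : hom_of u w = hpart d (hom_of u) w.
    have h0 w' : hpart (~~ d) (hom_of u) w' = 0.
      by rewrite -[LHS]emxK ?e /efun ?mulmx0 ?(lin0 (@edecode_linear _ _ _ _)) //;
        apply: hpart_linear.
    by rewrite -{1}(hpartD w hl); case: d {e} h0 => h0; rewrite h0 ?add0r ?addr0.
  by rewrite !fE hpart_degree.
have -> : emx (hpart (~~ d) (hom_of u)) = 0.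
  apply: emx_unique => x; rewrite mulmx0 hpart_other //.
  by rewrite (lin0 (@ecoor_linear _ _ _ _)).
by rewrite linear0 row_mx0.
Qed.

End Base.
Arguments hom_of {F} phi u.

(** Every unsigned homomorphism is the sum of its even and odd parts, which are
    again homomorphisms. *)
Lemma rank_hom_split (F : fieldType) (phi : {rmorphism O -> F}) :
  \rank (kermx (map_mx phi hom_mx)) =
  (\rank (kermx (map_mx phi (hom_deg_mx false))) +
   \rank (kermx (map_mx phi (hom_deg_mx true))))%N.
Proof.
set K0 := kermx (map_mx phi (hom_deg_mx false)).
set K1 := kermx (map_mx phi (hom_deg_mx true)).
have kP d (u : 'rV_(dim M * dim N)) : (u <= kermx (map_mx phi (hom_deg_mx d)))%MS <->
    mhom (hom_of phi u) /\ degree d (hom_of phi u).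
  by rewrite -hom_deg_mxP sub_kermx; split=> [/eqP|->].
rewrite -mxrank_disjoint_sum; last first.
  apply/eqP; rewrite -submx0; apply/rV_subP => u.
  rewrite sub_capmx => /andP[/kP[hu d0] /kP[_ d1]]; rewrite submx0.
  rewrite -[u](@emx_hom_of _ phi); have -> : emx (hom_of phi u) = 0.
    apply: emx_unique => x; rewrite mulmx0 -(hpart_id d1) (hpart_other _ d0).
    by rewrite (lin0 (@ecoor_linear _ _ _ _)).
  by rewrite linear0.
apply: eqmx_rank; apply/andP; split; last first.
  rewrite addsmx_sub; apply/andP; split; apply/rV_subP => u /kP[hu _];
  by rewrite sub_kermx; apply/eqP/hom_mxP.
apply/rV_subP => u; rewrite sub_kermx => /eqP/hom_mxP hu.
have hl := @hom_of_linear _ phi u.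
pose w d := mxvec (emx (hpart d (hom_of phi u))).
have wP d : (w d <= kermx (map_mx phi (hom_deg_mx d)))%MS.
  have hp : hom_of phi (w d) =1 hpart d (hom_of phi u).
    by apply: hom_of_emx; apply: hpart_linear.
  rewrite kP; have [el ea] := hpart_mhom d hu; split; first split.
  - exact: hom_of_linear.
  - by move=> a v; rewrite !hp ea.
  by move=> b v; rewrite !hp hpart_degree.
have -> : u = w false + w true.
  rewrite -linearD /= -{1}[u](@emx_hom_of _ phi); congr mxvec.
  apply: emx_unique => x; rewrite mulmxDr -!emxP; try exact: hpart_linear.
  by rewrite -(linD (@ecoor_linear _ _ _ _)) hpartD.
by apply: addmx_sub_adds; apply: wP.
Qed.

(** Exactness at the residue field: a matrix in the kernel of [der_mx] describes a
    derivation of the reduced algebra, and those are inner. *)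
Lemma kermx_der_mx (k : fieldType) (res : {rmorphism O -> k}) :
  semisimple (ext res A) ->
  (kermx (map_mx res der_mx) <= map_mx res hom_mx)%MS.
Proof.
move=> ssA; apply/rV_subP => u; rewrite sub_kermx => /eqP u0.
pose D : 'M[k]_(dim A, dim M * dim N) := vec_mx u.
have lD i j : leibniz (fun i => map_mx res (struct_mx i))
    (fun i => map_mx res (actmx M (abasis i)))
    (fun i => map_mx res (actmx N (abasis i))) D i j = 0.
  move: i j; apply/cobound1_eq0; apply: (can_inj mxvecK).
  rewrite -(mxvec_linE _ (@cobound1_linear _ _ _ _ _ _ _)) vec_mxK linear0.
  by rewrite -map_cobound1.
pose Dm (a : ext res A) := vec_mx (ecoor a *m D) : 'M_(dim M, dim N).
have Dml : linear Dm.
  by move=> r a b; rewrite /Dm ecoor_linear mulmxDl -scalemxAl linearP.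
pose Df (a : ext res A) : ext res M -> ext res N := efun (Dm a).
have Dfl v : linear (Df^~ v).
  by move=> r a b; rewrite /Df /efun Dml mulmxDr -scalemxAr edecode_linear.
have Dfr a : linear (Df a) by apply: efun_linear.
have DfM a b v : Df (smul a b) v = sact a (Df b v) + Df a (sact b v).
  move: a; apply: ext_basis_eq => [||i].
  - exact: (lin_comp (Dfl v) (@smul_linear_l _ _ b)).
  - exact: lin_add (@sact_linear_l _ _ _ _) (Dfl _).
  move: b; apply: ext_basis_eq => [||j].
  - exact: (lin_comp (Dfl v) (@smul_linear_r _ _ _)).
  - apply: lin_add; first exact: (lin_comp (@sact_linear_r _ _ _ _) (Dfl v)).
    exact: (lin_comp (Dfr _) (@sact_linear_l _ _ _ v)).
  apply: (can_inj (@ecoorK _ _ _ N)); rewrite (linD (@ecoor_linear _ _ _ _)).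
  rewrite ecoor_sact !ecoor_efun ecoor_sact -!mulmxA -mulmxDr; congr (_ *m _).
  have Dmb l : Dm (ebasis res l) = vec_mx (row l D).
    by rewrite /Dm ecoor_basis -rowE.
  rewrite !Dmb; have := lD i j; rewrite /leibniz => /eqP.
  rewrite subr_eq0 subr_eq => /eqP; rewrite addrC => <-; rewrite /Dm; congr (vec_mx (_ *m _)).
  have := @ecoor_sact _ _ res A (reg A) (abasis i) (ebasis res j).
  by rewrite ecoor_basis -rowE.
have [f fl fD] := derivation_inner ssA Dfl Dfr DfM.
suff -> : u = mxvec (emx f) *m map_mx res hom_mx by apply: submxMl.
rewrite map_cobound0 (mxvec_linE _ (@cobound0_linear _ _ _ _ _ _)).
rewrite -[LHS]vec_mxK; congr mxvec; apply/row_matrixP => i; rewrite rowK.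
rewrite -/D -[LHS]vec_mxK; congr mxvec.
have -> : vec_mx (row i D) = Dm (ebasis res i) by rewrite /Dm ecoor_basis -rowE.
apply: eq_mulmx_row => c; rewrite -[c](@edecodeK _ _ res M) -ecoor_efun -/(Df _) fD.
rewrite (linB (@ecoor_linear _ _ _ _)) emxP // !ecoor_sact emxP //.
by rewrite mulmxBr !mulmxA.
Qed.

End HomMatrices.
Arguments hom_of {O A M N F} phi u.

Section CompareHoms.
Variables (O : comNzRingType) (K k : fieldType).
Variables (iota : {rmorphism O -> K}) (res : {rmorphism O -> k}).
Variables (A : superAlgType O) (M N : superModType A).
Hypotheses (iota_inj : injective iota) (ssA : semisimple (ext res A)).

Lemma rank_hom_eq :
  \rank (kermx (map_mx iota (hom_mx M N))) = \rank (kermx (map_mx res (hom_mx M N))).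
Proof.
rewrite !mxrank_ker; congr (_ - _)%N.
by apply: (rank_exact iota_inj (hom_der_mx M N)); apply: kermx_der_mx.
Qed.

Let sum_leq_eq (a b a' b' : nat) :
  (a <= a' -> b <= b' -> a + b = a' + b' -> a = a' /\ b = b')%N.
Proof.
move=> la lb e; have ea : a = a'.
  by apply/eqP; rewrite eqn_leq la -(leq_add2r b) e leq_add2l lb.
by split=> //; move: e; rewrite ea => /addnI.
Qed.

(** Each graded piece can only grow under reduction; the total does not. *)
Lemma rank_hom_deg_eq d :
  \rank (kermx (map_mx iota (hom_deg_mx M N d))) =
  \rank (kermx (map_mx res (hom_deg_mx M N d))).
Proof.
have le c : (\rank (kermx (map_mx iota (hom_deg_mx M N c))) <=
             \rank (kermx (map_mx res (hom_deg_mx M N c))))%N.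
  by rewrite !mxrank_ker leq_sub2l // rank_specialise.
have e := etrans (esym (rank_hom_split M N iota))
  (etrans rank_hom_eq (rank_hom_split M N res)).
have [e0 e1] := sum_leq_eq (le false) (le true) e.
by case: d; [apply: e1|apply: e0].
Qed.

End CompareHoms.

(** * Simple supermodules *)

Section SuperHoms.
Variables (R : comNzRingType) (A : superAlgType R).

Lemma homog_hom_comp (U V W : superModType A) d e (f : V -> W) (g : U -> V) :
  homog_hom d f -> homog_hom e g -> homog_hom (e (+) d) (f \o g).
Proof.
move=> [fl fh fa] [gl gh ga]; split=> [|b v hv|b a v ha] /=.
- exact: lin_comp.
- by rewrite addbA; apply/fh/gh.
rewrite (ga b) // (linZ fl) (fa b) // scalerA.
by rewrite andb_addl signr_addb.
Qed.

Lemma homog_hom_add (V W : superModType A) d (f g : V -> W) :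
  homog_hom d f -> homog_hom d g -> homog_hom d (fun v => f v + g v).
Proof.
move=> [fl fh fa] [gl gh ga]; split=> [|b v hv|b a v ha].
- exact: lin_add.
- by rewrite /homog linearD /= (fh _ _ hv) (gh _ _ hv).
by rewrite (fa b) // (ga b) // linearD scalerDr.
Qed.

Lemma superhom_comp (U V W : superModType A) (f : V -> W) (g : U -> V) :
  superhom f -> superhom g -> superhom (f \o g).
Proof.
move=> [f0 [f1 [f0h f1h fE]]] [g0 [g1 [g0h g1h gE]]].
exists (fun v => f0 (g0 v) + f1 (g1 v)), (fun v => f0 (g1 v) + f1 (g0 v)).
split.
- apply: homog_hom_add; first exact: (homog_hom_comp f0h g0h).
  exact: (homog_hom_comp f1h g1h).
- apply: homog_hom_add; first exact: (homog_hom_comp f0h g1h).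
  exact: (homog_hom_comp f1h g0h).
case: f0h f1h => f0l _ _ [f1l _ _] v /=.
by rewrite fE gE (linD f0l) (linD f1l) [X in _ + X]addrC addrACA.
Qed.

Lemma siso_trans (U V W : superModType A) : siso U V -> siso V W -> siso U W.
Proof.
move=> [f [f' [fh f'h fK f'K]]] [g [g' [gh g'h gK g'K]]].
exists (g \o f), (f' \o g'); split; try exact: superhom_comp.
  exact: can_comp.
exact: can_comp.
Qed.

Lemma endo_dim_siso (V W : superModType A) n :
  siso V W -> endo_dim V n -> endo_dim W n.
Proof.
move=> [f [g [fh gh fK gK]]] [e [eh eP]].
have [fl gl] := (superhom_linear fh, superhom_linear gh).
exists (fun i => f \o (e i \o g)); split=> [i|h hh].
  by apply: superhom_comp => //; apply: superhom_comp.
have [|c [cP cU]] := eP (g \o (h \o f)).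
  by apply: superhom_comp => //; apply: superhom_comp.
exists c; split=> [w|c' c'P].
  rewrite -[LHS]gK -{1}[w]gK; have /= -> := cP (g w).
  by rewrite (lin_sum fl); apply: eq_bigr => i _; rewrite (linZ fl).
apply: cU => v /=; rewrite c'P (lin_sum gl); apply: eq_bigr => i _.
by rewrite (linZ gl) /= !fK.
Qed.

(** Full superendomorphisms and unsigned endomorphisms correspond under the
    involution f0 + f1 <-> f0 + f1 \o twist. *)
Definition untwist (V W : superModType A) (f : V -> W) (v : V) : W :=
  hpart false f v + hpart true f (twist true v).

Section Untwist.
Variables V W : superModType A.
Implicit Types f : V -> W.

Lemma untwist_linear f : linear f -> linear (untwist f).
Proof.
move=> fl; apply: lin_add; first exact: hpart_linear.
apply: lin_comp; [exact: hpart_linear|exact: twist_linear].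
Qed.

Lemma eq_untwist f g : f =1 g -> untwist f =1 untwist g.
Proof. by move=> e v; rewrite /untwist /hpart !e. Qed.

Lemma untwist_homog f0 f1 : linear f0 -> linear f1 ->
  degree false f0 -> degree true f1 ->
  untwist (fun v => f0 v + f1 v) =1 fun v => f0 v + f1 (twist true v).
Proof.
move=> l0 l1 d0 d1 v.
have H d : hpart d (fun v => f0 v + f1 v) =1 fun v => hpart d f0 v + hpart d f1 v.
  by move=> w; rewrite /hpart !linearD /= addrACA.
rewrite /untwist !H (hpart_id d0) (hpart_id d1).
by rewrite (hpart_other _ d0) (hpart_other _ d1) addr0 add0r.
Qed.

Lemma degree_twist f : degree true f -> degree true (f \o twist true).
Proof.
move=> fd b v; apply: etrans (fd b (twist true v)); rewrite /comp; congr f.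
by rewrite spart_twist (twist_homog _ (spart_homog b v)).
Qed.

Lemma untwistK f : linear f -> untwist (untwist f) =1 f.
Proof.
move=> fl v; rewrite untwist_homog.
- by rewrite twistK hpartD.
- exact: hpart_linear.
- apply: lin_comp; [exact: hpart_linear|exact: twist_linear].
- exact: hpart_degree.
by apply: degree_twist; apply: hpart_degree.
Qed.

Lemma mhom_untwist f : superhom f -> mhom (untwist f).
Proof.
move=> fh; have fl := superhom_linear fh; have [f0 [f1 [h0 h1 fE]]] := fh.
have [d0 d1] := (homog_hom_degree h0, homog_hom_degree h1).
have [l0 a0] := homog_hom_mhom h0; have [l1 a1] := homog_hom_mhom h1.
case: h0 h1 => fl0 _ _ [fl1 _ _].
have e : untwist f =1 fun v => f0 v + f1 (twist true v).
  by move=> v; apply: etrans (untwist_homog fl0 fl1 d0 d1 v); apply: eq_untwist.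
split=> [|a v]; first exact: untwist_linear.
by rewrite !e linearD /=; congr (_ + _); [apply: a0|apply: a1].
Qed.

Lemma superhom_untwist f : mhom f -> superhom (untwist f).
Proof.
move=> fh; have [fl _] := fh.
exists (hpart false f), (hpart true f \o twist true); split=> //.
  exact: (mhom_homog_hom (hpart_mhom false fh) (hpart_degree false fl)).
exact: (mhom_homog_hom (hpart_mhom true fh) (hpart_degree true fl)).
Qed.

Lemma untwist_sum n (c : 'rV[R]_n) (e : 'I_n -> V -> W) :
  untwist (fun v => \sum_i c 0 i *: e i v) =1
  fun v => \sum_i c 0 i *: untwist (e i) v.
Proof.
move=> v; rewrite /untwist /hpart !linear_sum -!big_split.
by apply: eq_bigr => i _; rewrite !linearZ /= -!scalerDr.
Qed.

End Untwist.

Lemma simple_ker (T S : superModType A) d (f : T -> S) :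
  simple_mod T -> mhom f -> degree d f -> (exists v, f v <> 0) -> injective f.
Proof.
move=> [_ sT] [fl fa] fd [v0 fv0].
have [|f0|fT] := sT (fun v => f v = 0).
- split=> [|u v fu fv|r u fu|a u fu|b u fu]; first exact: lin0.
  + by rewrite (linD fl) fu fv addr0.
  + by rewrite (linZ fl) fu scaler0.
  + by rewrite fa fu linear0.
  by rewrite fd fu linear0.
- move=> u v uv; apply/eqP; rewrite -subr_eq0; apply/eqP.
  have : [set 0]%classic (u - v) by rewrite -f0 (linB fl) uv subrr.
  by [].
by case: fv0; have : setT v0 by []; rewrite -fT.
Qed.

Lemma simple_im (T S : superModType A) d (f : T -> S) :
  simple_mod S -> mhom f -> degree d f -> (exists v, f v <> 0) ->
  forall w, exists v, f v = w.
Proof.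
move=> [_ sS] [fl fa] fd [v0 fv0] w.
have [|f0|fT] := sS (fun w => exists v, f v = w).
- split=> [|_ _ [u <-] [v <-]|r _ [u <-]|a _ [u <-]|b _ [u <-]].
  + by exists 0; apply: lin0.
  + by exists (u + v); rewrite (linD fl).
  + by exists (r *: u); rewrite (linZ fl).
  + by exists (sact a u); rewrite fa.
  by exists (spart (b (+) d) u); rewrite fd -addbA addbb addbF.
- by case: fv0; have : [set 0]%classic (f v0) by rewrite -f0; exists v0.
by have : setT w by []; rewrite -fT.
Qed.

Lemma inj_surj_bij (X Y : Type) (f : X -> Y) :
  injective f -> (forall y, exists x, f x = y) -> bijective f.
Proof. by move=> fI /choice[g fg]; exists g => // x; apply: fI. Qed.

Lemma hpart_neq0 (T S : superModType A) (f : T -> S) v : linear f -> f v <> 0 ->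
  exists d, hpart d f v <> 0.
Proof.
move=> fl fv; have [f0|f0] := EM (hpart false f v = 0); last by exists false.
by exists true; rewrite -(hpartD _ fl) f0 add0r in fv.
Qed.

(** It is enough to have a nonzero unsigned map: one of its homogeneous parts is
    nonzero, hence bijective, and composing it with [twist] restores the signs. *)
Lemma schur (T S : superModType A) (f : T -> S) :
  simple_mod T -> simple_mod S -> mhom f -> (exists v, f v <> 0) -> siso T S.
Proof.
move=> sT sS fh [v fv]; have [fl _] := fh.
have [d fd] := hpart_neq0 fl fv.
have dh := hpart_mhom d fh; have dd := hpart_degree d fl.
apply: (siso_of_homog (mhom_homog_hom dh dd)).
apply: bij_comp; last exact: inv_bij (@twistK _ T d).
apply: inj_surj_bij; first by apply: (simple_ker sT dh dd); exists v.
by apply: (simple_im sS dh dd); exists v.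
Qed.

End SuperHoms.

Section SimpleOverField.
Variables (F : fieldType) (B : superAlgType F).

Lemma inj_lin_surj (V : vectType F) (f : V -> V) :
  linear f -> injective f -> forall w, exists v, f v = w.
Proof.
move=> fl fI w.
pose L : {linear V -> V} := HB.pack f (GRing.isLinear.Build _ _ _ _ f fl).
have ker0 : lker (linfun L) == 0%VS.
  by apply/lker0P => u v; rewrite !lfunE; apply: fI.
by exists ((linfun L)^-1%VF w); have := lker0_lfunVK ker0 w; rewrite lfunE.
Qed.

(** An isomorphism out of a simple module can be made homogeneous: a nonzero
    homogeneous component is injective, hence bijective by dimension. *)
Lemma siso_degree (T S : superModType B) : simple_mod T -> siso T S ->
  exists d (f : T -> S), [/\ mhom f, degree d f & bijective f].
Proof.
move=> sT [f [g [[f0 [f1 [h0 h1 fE]]] gh fK gK]]].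
have gl := superhom_linear gh.
have [[v v0] _] := sT.
have fv : f v <> 0.
  by move=> e; apply: v0; rewrite -[v]fK e (lin0 gl).
have [d [fd hd [w fdw]]] : exists d, exists2 fd : T -> S, homog_hom d fd & exists v, fd v <> 0.
  have [e|e] := EM (f0 v = 0); last by exists false, f0 => //; exists v.
  by exists true, f1 => //; exists v; rewrite fE e add0r in fv.
have mh := homog_hom_mhom hd.
have md : degree d (fd \o twist d).
  have := homog_hom_degree hd; case: d {hd mh} => //; exact: degree_twist.
exists d, (fd \o twist d); split=> //.
have inj : injective (fd \o twist d).
  by apply: (simple_ker sT mh md); exists (twist d w); rewrite /= twistK.
apply: inj_surj_bij => // y.
have hl : linear (g \o (fd \o twist d)) by case: mh => l _; apply: lin_comp.
have hI : injective (g \o (fd \o twist d)) := inj_comp (can_inj gK) inj.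
have [u gu] := inj_lin_surj hl hI (g y).
by exists u; apply: (can_inj gK).
Qed.

Lemma simple_siso (T S : superModType B) : simple_mod T -> siso T S -> simple_mod S.
Proof.
move=> sT iTS; have [d [f [[fl fa] fd [g fK gK]]]] := siso_degree sT iTS.
have [[v v0] subT] := sT; split.
  by exists (f v) => e; apply: v0; apply: (can_inj fK); rewrite e (lin0 fl).
move=> U [U0 UD UZ UA Us].
have [|e|e] := subT (fun v => U (f v)).
- split=> [|x y Ux Uy|r x Ux|a x Ux|b x Ux].
  + by rewrite (lin0 fl).
  + by rewrite (linD fl); apply: UD.
  + by rewrite (linZ fl); apply: UZ.
  + by rewrite fa; apply: UA.
  by rewrite fd; apply: Us.
- left; apply/seteqP; split=> [w Uw|w ->//].
  have : [set 0]%classic (g w) by rewrite -e gK.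
  by move=> /= g0; rewrite -[w]gK g0 (lin0 fl).
right; apply/seteqP; split=> // w _; have : setT (g w) by [].
by rewrite -e gK.
Qed.

(** Over a semisimple algebra a module whose even endomorphisms are scalars is
    simple: let e be a projection along a proper graded submodule U <> 0.  Its
    even part is a scalar killing U, hence 0; so e is odd and idempotent, hence 0. *)
Lemma simple_of_even_scalar (T : superModType B) : semisimple B ->
  (exists v : T, v <> 0) ->
  (forall f : T -> T, mhom f -> degree false f -> exists a, forall v, f v = a *: v) ->
  simple_mod T.
Proof.
move=> ssB T0 sc; split=> // U [U0 UD UZ UA Us].
have [|W WP] := vspace_of_set U0; first by move=> a u v Uu Uv; apply: UD => //; apply: UZ.
have sW : submod W by move=> a v /WP Uv; apply/WP; apply: UA.
have [e [eh eW e_proj]] := projection_along ssB sW; have [el _] := eh.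
have [Uu|Unu] := EM (exists2 u, U u & u <> 0); last first.
  left; apply/seteqP; split=> [u Uu|_ ->//].
  by apply: contrapT => u0; apply: Unu; exists u.
right; apply/seteqP; split=> // v _; have [u uU u0] := Uu.
have [a aP] := sc _ (hpart_mhom false eh) (hpart_degree false el).
have a0 : a = 0.
  have := aP u; rewrite /hpart !eW; try by apply/WP; apply: Us.
  rewrite !linear0 addr0 => /esym/eqP; rewrite scaler_eq0 => /orP[/eqP//|/eqP//].
have ed : degree true e.
  have eE w : e w = hpart true e w by rewrite -{1}(hpartD _ el) aP a0 scale0r add0r.
  by move=> b w; rewrite !eE hpart_degree.
have ee w : e (e w) = e w.
  by apply/eqP; rewrite -subr_eq0 -(linB el) -opprB (linN el) eW ?oppr0.
have e0 b w : e (spart b w) = 0.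
  have h : e (spart b w) = spart b (e w).
    by rewrite -ee !ed ee -addbA addbb addbF.
  by rewrite h -spart_id -h ed spartK; case: b {h}.
have ev : e v = 0 by rewrite -(spartD v) (linD el) !e0 addr0.
by apply/WP; have := e_proj v; rewrite ev subr0.
Qed.

End SimpleOverField.

(** * Reduction of homomorphisms and of simple modules *)

Section HomRank.
Variables (O : comNzRingType) (F : fieldType) (phi : {rmorphism O -> F}).
Variables (A : superAlgType O) (M N : superModType A).

Lemma eq_mhom (R : comNzRingType) (B : superAlgType R) (V W : superModType B)
  (f g : V -> W) : f =1 g -> mhom f -> mhom g.
Proof. by move=> /funext <-. Qed.

Lemma hom_nonzero_rank :
  (exists2 f : ext phi M -> ext phi N, mhom f & exists v, f v <> 0) <->
  (0 < \rank (kermx (map_mx phi (hom_mx M N))))%N.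
Proof.
rewrite lt0n mxrank_eq0; split=> [[f fh [v fv]]|K0].
  have [fl _] := fh; apply: contra_notN fv => /eqP K0.
  have : (mxvec (emx f) <= kermx (map_mx phi (hom_mx M N)))%MS.
    rewrite sub_kermx; apply/eqP/hom_mxP; apply: eq_mhom fh => w.
    by rewrite hom_of_emx.
  rewrite K0 submx0 => /eqP u0; rewrite -(hom_of_emx fl) u0.
  by rewrite /hom_of linear0 /efun mulmx0 (lin0 (@edecode_linear _ _ _ _)).
set K := kermx _ in K0.
have uK : (nz_row K <= K)%MS by apply: nz_row_sub.
exists (hom_of phi (nz_row K)).
  by apply/hom_mxP/eqP; rewrite -sub_kermx.
apply: contrapT => z; case/negP: K0; rewrite -nz_row_eq0.
rewrite -(@emx_hom_of _ _ _ _ _ phi (nz_row K)).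
have -> : emx (hom_of phi (nz_row K)) = 0; last by rewrite linear0.
apply: emx_unique => x; rewrite mulmx0.
have -> : hom_of phi (nz_row K) x = 0 by apply: contrapT => zx; apply: z; exists x.
by rewrite (lin0 (@ecoor_linear _ _ _ _)).
Qed.

End HomRank.

Section EndoRank.
Variables (O : comNzRingType) (F : fieldType) (phi : {rmorphism O -> F}).
Variables (A : superAlgType O) (M : superModType A).
Local Notation V := (ext phi M).

Let ker := kermx (map_mx phi (hom_mx M M)).

Let kerP (f : V -> V) : linear f -> (mxvec (emx f) <= ker)%MS <-> mhom f.
Proof.
move=> fl; rewrite sub_kermx; split=> [/eqP/hom_mxP|fh].
  by apply: eq_mhom; apply: hom_of_emx.
apply/eqP/hom_mxP; apply: eq_mhom fh => w; by rewrite hom_of_emx.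
Qed.

Let row_comb n (Z : 'M[F]_(n, dim M * dim M)) (c : 'rV_n) :
  hom_of phi (c *m Z) =1 fun v => \sum_i c 0 i *: hom_of phi (row i Z) v.
Proof.
move=> v; rewrite mulmx_sum_row /hom_of linear_sum /efun mulmx_sumr.
rewrite (lin_sum (@edecode_linear _ _ _ _)); apply: eq_bigr => i _.
by rewrite linearZ /= -scalemxAr (linZ (@edecode_linear _ _ _ _)).
Qed.

(** Through [untwist], the full superendomorphism algebra has the dimension of
    the space of unsigned endomorphisms. *)
Lemma endo_dim_rank n : endo_dim (V : superModType (ext phi A)) n <-> \rank ker = n.
Proof.
split=> [[e [eh eP]]|<-]; last first.
  pose Z := row_base ker.
  have gh i : mhom (hom_of phi (row i Z)).
    apply/hom_mxP/eqP; rewrite -sub_kermx.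
    by apply: submx_trans (row_sub i Z) _; rewrite eq_row_base.
  exists (fun i => untwist (hom_of phi (row i Z))).
  split=> [i|f fh]; first exact: superhom_untwist.
  have fl := superhom_linear fh.
  have [ul _] := mhom_untwist fh.
  have : (mxvec (emx (untwist f)) <= Z)%MS.
    by rewrite (eq_row_base ker) (kerP ul); apply: mhom_untwist.
  move=> /submxP[c cE]; exists c; split=> [v|c' c'P].
    rewrite -(untwistK fl) -untwist_sum; apply: eq_untwist => w.
    by rewrite -row_comb -cE hom_of_emx.
  apply: (row_free_inj (row_base_free ker)); rewrite -/Z -cE.
  rewrite -[RHS](@emx_hom_of _ _ _ _ _ phi); congr mxvec; apply: emx_unique => x.
  rewrite -emxP; last exact: hom_of_linear.
  congr ecoor; rewrite row_comb.
  have -> : untwist f x = untwist (fun v => \sum_i c' 0 i *: untwist (hom_of phi (row i Z)) v) x.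
    by apply: eq_untwist.
  rewrite untwist_sum; apply: eq_bigr => i _; rewrite untwistK //.
  exact: hom_of_linear.
have el i := superhom_linear (eh i).
have ul i : linear (untwist (e i)) by apply: untwist_linear.
pose Z : 'M[F]_(n, dim M * dim M) := \matrix_i mxvec (emx (untwist (e i))).
have rowZ i : hom_of phi (row i Z) =1 untwist (e i).
  by move=> v; rewrite rowK hom_of_emx.
have combZ c : hom_of phi (c *m Z) =1 untwist (fun v => \sum_i c 0 i *: e i v).
  by move=> v; rewrite row_comb untwist_sum; apply: eq_bigr => i _; rewrite rowZ.
have combl (c : 'rV_n) : linear (fun v => \sum_i c 0 i *: e i v).
  by apply: lin_bigsum => i a u v; rewrite el scalerDr !scalerA mulrC.
have freeZ : row_free Z.
  apply: inj_row_free => c cZ.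
  have [|c0 [_ c0U]] := eP (fun=> 0).
    exact: homog_superhom (homog_hom0 V V false).
  have z v : \sum_i c 0 i *: e i v = 0.
    rewrite -(untwistK (combl c)).
    have -> : untwist (untwist (fun v => \sum_i c 0 i *: e i v)) v = untwist (fun=> 0 : V) v.
      apply: eq_untwist => w; rewrite -combZ cZ /hom_of linear0 /efun mulmx0.
      by rewrite (lin0 (@edecode_linear _ _ _ _)).
    by rewrite /untwist /hpart !linear0 !addr0.
  rewrite -(c0U c) // -[RHS](c0U 0) // => v.
  by rewrite big1 // => i _; rewrite mxE scale0r.
have <- : \rank Z = n by apply/eqP.
apply: eqmx_rank; apply/andP; split; last first.
  by apply/row_subP => i; rewrite rowK kerP //; apply: mhom_untwist.
apply/rV_subP => u; rewrite sub_kermx => /eqP/hom_mxP uh.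
have [c [cP _]] := eP _ (superhom_untwist uh).
have -> : u = c *m Z; last exact: submxMl.
rewrite -[LHS](@emx_hom_of _ _ _ _ _ phi) -[RHS](@emx_hom_of _ _ _ _ _ phi).
congr mxvec; apply: emx_unique => x; rewrite -emxP; last exact: hom_of_linear.
congr ecoor; rewrite combZ -(eq_untwist (f := untwist (hom_of phi u))) //.
by rewrite untwistK //; apply: hom_of_linear.
Qed.

End EndoRank.

Section Reduction.
Variables (O : comNzRingType) (K k : fieldType).
Variables (iota : {rmorphism O -> K}) (res : {rmorphism O -> k}).
Variables (A : superAlgType O).
Hypotheses (iota_inj : injective iota) (ssA : semisimple (ext res A)).

Lemma hom_nonzero_reduction (M N : superModType A) :
  (exists2 f : ext iota M -> ext iota N, mhom f & exists v, f v <> 0) <->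
  (exists2 f : ext res M -> ext res N, mhom f & exists v, f v <> 0).
Proof. by rewrite !hom_nonzero_rank (rank_hom_eq M N iota_inj ssA). Qed.

Lemma endo_dim_reduction (M : superModType A) n :
  endo_dim (ext iota M : superModType (ext iota A)) n ->
  endo_dim (ext res M : superModType (ext res A)) n.
Proof. by move/endo_dim_rank; rewrite (rank_hom_eq M M iota_inj ssA) => /endo_dim_rank. Qed.

(** If the even endomorphisms over the fraction field form a line, so do those of
    the reduction, because the two spaces have equal dimension; the line is then
    spanned by the identity. *)
Lemma simple_reduction (M : superModType A) :
  (exists v : ext iota M, v <> 0) ->
  (forall f : ext iota M -> ext iota M, mhom f -> degree false f ->
     exists a, forall v, f v = a *: v) ->
  simple_mod (ext res M : superModType (ext res A)).
Proof.
move=> [v0 v0n0] sc.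
have M_gt0 : (0 < dim M)%N.
  rewrite lt0n; apply: contra_notN v0n0 => /eqP M0.
  apply: (can_inj (@ecoorK _ _ _ M)); apply/rowP => -[i lti].
  by exfalso; rewrite M0 in lti.
pose i0 := Ordinal M_gt0.
have one_neq0 : mxvec (1%:M : 'M[k]_(dim M)) != 0.
  apply/eqP => /(canRL mxvecK); rewrite linear0 => /matrixP/(_ i0 i0)/eqP.
  by rewrite !mxE eqxx oner_eq0.
have one_ker : (mxvec (1%:M : 'M[k]_(dim M)) <=
    kermx (map_mx res (hom_deg_mx M M false)))%MS.
  rewrite sub_kermx; apply/eqP/hom_deg_mxP.
  have id_ : hom_of res (mxvec (1%:M : 'M[k]_(dim M))) =1 (@id (ext res M)).
    by move=> x; rewrite /hom_of mxvecK /efun mulmx1 ecoorK.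
  by rewrite (funext id_); split=> // b v; rewrite addbF.
have rank1 : (\rank (kermx (map_mx res (hom_deg_mx M M false))) <= 1)%N.
  rewrite -(rank_hom_deg_eq M M iota_inj ssA).
  apply: leq_trans (mxrankS (_ : _ <= mxvec (1%:M : 'M[K]_(dim M)))%MS) (rank_leq_row _).
  apply/rV_subP => u; rewrite sub_kermx => /eqP/hom_deg_mxP[uh ud].
  have [a aP] := sc _ uh ud; apply/sub_rVP; exists a.
  rewrite -linearZ -[LHS](@emx_hom_of _ _ _ _ _ iota) /=; congr mxvec.
  apply: emx_unique => x; rewrite aP (linZ (@ecoor_linear _ _ _ _)).
  by rewrite scalemx1 mul_mx_scalar.
apply: simple_of_even_scalar => // [|f fh fd].
  exists (ebasis res i0) => /(congr1 (@ecoor _ _ _ M)).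
  rewrite ecoor_basis (lin0 (@ecoor_linear _ _ _ _)) => /rowP/(_ i0)/eqP.
  by rewrite !mxE !eqxx oner_eq0.
have [fl _] := fh.
have : (mxvec (emx f) <= mxvec (1%:M : 'M[k]_(dim M)))%MS.
  have kle : (kermx (map_mx res (hom_deg_mx M M false)) <=
      mxvec (1%:M : 'M[k]_(dim M)))%MS.
    rewrite -(geq_leqif (mxrank_leqif_sup one_ker)).
    by apply: leq_trans rank1 _; rewrite rank_rV one_neq0.
  apply: submx_trans kle.
  rewrite sub_kermx; apply/eqP/hom_deg_mxP.
  by rewrite (funext (hom_of_emx fl)).
move=> /sub_rVP[a]; rewrite -linearZ => /(can_inj mxvecK) e; exists a => v.
apply: (can_inj (@ecoorK _ _ _ M)); rewrite emxP // e.
by rewrite (linZ (@ecoor_linear _ _ _ _)) scalemx1 mul_mx_scalar.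
Qed.

End Reduction.

(** * Split simple modules *)

Lemma root_in_extension (F : fieldType) (p : {poly F}) : (1 < size p)%N ->
  exists (L : fieldType) (iota : {rmorphism F -> L}) (z : L),
    root (map_poly iota p) z.
Proof.
have [n] := ubnP (size p); elim: n p => // n IH p /ltnSE pn p1.
have [irr|nirr] := EM (irreducible_poly p).
  have [L _ [z rz _]] := irredp_FAdjoin irr.
  by exists L, (in_alg L), z.
have [q [q1 qp nq]] : exists q : {poly F}, [/\ size q != 1, q %| p & ~~ (q %= p)].
  apply: contrapT => H; apply: nirr; split=> // q q1 qp.
  by apply: contrapT => /negP nq; apply: H; exists q.
have p0 : p != 0 by rewrite -size_poly_gt0 (ltn_trans _ p1).
have q0 : q != 0 by apply: contraTneq qp => ->; rewrite dvd0p.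
have qs : (size q < size p)%N by rewrite ltn_neqAle dvdp_leq // andbT dvdp_size_eqp.
have [||L [iota [z rz]]] := IH q; first exact: leq_trans qs pn.
  by rewrite ltn_neqAle eq_sym q1 size_poly_gt0.
exists L, iota, z; have /dvdpP[r ->] := qp.
by rewrite rmorphM rootM rz orbT.
Qed.

Section SplitScalar.
Variables (F : fieldType) (B : superAlgType F) (V : superModType B).

(** After adjoining an eigenvalue of f, the map f - z has a kernel on the
    extended module, which is still simple; so f is the scalar z. *)
Lemma split_even_scalar : simple_mod V -> split_mod V ->
  forall f : V -> V, mhom f -> degree false f -> exists a, forall v, f v = a *: v.
Proof.
move=> [[v0 v0n0] _] spV f [fl fa] fd.
have V_gt0 : (0 < dim V)%N.
  rewrite lt0n; apply: contra_notN v0n0 => /eqP V0.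
  apply: (can_inj (@v2rK _ V)); apply/rowP => -[i lti].
  by exfalso; rewrite V0 in lti.
pose i0 := Ordinal V_gt0.
pose X : 'M[F]_(dim V) := \matrix_i v2r (f (r2v (delta_mx 0 i))).
have XP v : v2r (f v) = v2r v *m X.
  rewrite -{1}[v]v2rK [v2r v]row_sum_delta linear_sum (lin_sum fl) linear_sum.
  rewrite mulmx_suml; apply: eq_bigr => i _.
  by rewrite linearZ /= (linZ fl) linearZ /= -scalemxAl -rowE rowK.
have [|L [iota [z]]] := @root_in_extension F (char_poly X).
  by rewrite size_char_poly ltnS.
rewrite map_char_poly -eigenvalue_root_char => /eigenvalueP[w wX w0].
have tl := @tens1_semilin _ _ iota V.
have sl : semilin iota (fun v => tens1 iota (f v)).
  by move=> a u v; rewrite fl tl.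
pose f' : ext iota V -> ext iota V := ext_lift (fun v => tens1 iota (f v)).
have f'l : linear f' by apply: ext_lift_linear.
have f't v : f' (tens1 iota v) = tens1 iota (f v) by apply: ext_lift_tens1.
have f'X x : ecoor (f' x) = ecoor x *m map_mx iota X.
  move: x; apply: ext_linear_eq => [r x y|r x y|v].
  - by rewrite f'l ecoor_linear.
  - by rewrite ecoor_linear mulmxDl scalemxAl.
  by rewrite f't !ecoor_tens1 XP map_mxM.
have f'h : mhom f'.
  split=> // a x; move: a; apply: ext_linear_eq => [r a b|r a b|a].
  - by rewrite sact_linear_l f'l.
  - by rewrite sact_linear_l.
  move: x; apply: ext_linear_eq => [r x y|r x y|v].
  - by rewrite linearP f'l.
  - by rewrite f'l linearP.
  by rewrite f't !sact_tens1 f't fa.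
have f'd : degree false f'.
  move=> b x; rewrite addbF; move: x; apply: ext_linear_eq => [r x y|r x y|v].
  - by rewrite linearP f'l.
  - by rewrite f'l linearP.
  by rewrite spart_tens1 !f't spart_tens1 fd addbF.
pose g x := f' x - z *: x.
have gl : linear g.
  by move=> r x y; rewrite /g f'l scalerDr opprD scalerBr !scalerA [z * r]mulrC addrACA.
have gh : mhom g.
  split=> // a x; case: f'h => _ h.
  by rewrite /g h [RHS]linearB /= [sact a (z *: x)]linearZ.
have gd : degree false g.
  by move=> b x; rewrite /g f'd addbF [RHS]linearB /= [spart b (z *: x)]linearZ.
have g0 x : g x = 0.
  apply: contrapT => gx; have gI := simple_ker (spV L iota) gh gd (ex_intro _ x gx).
  case/eqP: w0; rewrite -[w](@edecodeK _ _ iota V).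
  have -> : edecode iota w = 0; last exact: lin0 (@ecoor_linear _ _ _ _).
  apply: gI; rewrite (lin0 gl); apply: (can_inj (@ecoorK _ _ _ V)).
  rewrite /g (linB (@ecoor_linear _ _ _ _)) (linZ (@ecoor_linear _ _ _ _)) f'X.
  by rewrite edecodeK wX subrr (lin0 (@ecoor_linear _ _ _ _)).
have fz v : map_mx iota (v2r (f v)) = z *: map_mx iota (v2r v).
  have /eqP := g0 (tens1 iota v); rewrite /g f't subr_eq0 => /eqP.
  by move/(congr1 (@ecoor _ _ _ V)); rewrite (linZ (@ecoor_linear _ _ _ _)) !ecoor_tens1.
pose b0 : V := r2v (delta_mx 0 i0).
have zE : z = iota (v2r (f b0) 0 i0).
  by have /rowP/(_ i0) := fz b0; rewrite !mxE r2vK !mxE !eqxx rmorph1 mulr1.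
exists (v2r (f b0) 0 i0) => v; apply: (can_inj (@v2rK _ V)).
apply: (@map_mx_inj _ _ iota); rewrite fz zE linearZ /= map_mxZ //.
Qed.

End SplitScalar.

(** * Blocks and determinants *)

Section Annihilator.
Variables (F : fieldType) (B : superAlgType F).
Hypothesis ssB : semisimple B.

Definition kills (V : superModType B) (b : B) := forall v : V, sact b v = 0.

(** The annihilator of S is a two-sided ideal with a right identity p.  For y in
    it, y' = y - p y satisfies y' B y' = 0, so y' lies in the radical: p is also
    a left identity. *)
Lemma annihilator_left_identity (S : superModType B) :
  exists2 p : B, kills S p & forall y, kills S y -> smul p y = y.
Proof.
have [||P PP] := @vspace_of_set _ (reg B) (kills S).
- by move=> s; rewrite sact0l.
- by move=> r a b ka kb s; rewrite sactDl sactZl ka kb scaler0 addr0.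
have sP : submod P.
  by move=> a b /PP kb; apply/PP => s; rewrite [sact a b]/(smul a (b : B)) sactA kb linear0.
have [e [[el eM] eP e_proj]] := projection_along ssB sP.
pose q : B := e (sone : B); pose p : B := sone - q.
have yq y : kills S y -> smul y q = 0.
  move=> /PP yP; have := eM y (sone : B);
    have -> : sact y ((sone : B) : reg B) = y by apply: smulx1.
  by rewrite eP // => /esym.
have pE y : smul p y = y - smul q y by rewrite (linB (smul_linear_l y)) smul1x.
exists p => [|y ky]; first by apply/PP; apply: e_proj.
have kyb b : kills S (smul y b) by move=> s; rewrite sactA ky.
pose y' := smul q y.
suff y'0 : y' = 0 by rewrite pE -/y' y'0 subr0.
apply: contrapT => /(radical_avoid ssB)[I mI Iy'].
have [i [b [Ii iE]]] := maximal_cover mI Iy' sone.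
have y'b : smul y' (smul b y') = 0.
  rewrite /y' -!smulA smulA -smulA [smul y _]smulA [smul (smul y b) _]smulA.
  by rewrite yq // !(lin0 (smul_linear_l _)) (lin0 (smul_linear_r _)).
apply: Iy'; rewrite -[y']smulx1 iE (linD (smul_linear_r y')) y'b addr0.
by case: mI => [[_ _ IM] _ _]; apply: IM.
Qed.

(** If the left identity p of the annihilator of S is not injective on T, then T
    has a nonzero map to B whose image does not annihilate S. *)
Lemma block_hom (S T : superModType B) (p : B) (t : T) :
  (forall y, kills S y -> smul p y = y) -> t <> 0 -> sact p t = 0 ->
  exists2 g : T -> S, mhom g & exists v, g v <> 0.
Proof.
move=> pP t0 pt.
have s0 : submod (0%VS : {vspace T}).
  by move=> a v; rewrite !memv0 => /eqP->; rewrite linear0.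
have [n [i [x [ih _ ix]]]] := dual_basis ssB s0.
have [j yj] : exists j, i j t <> 0.
  apply: contrapT => H; apply: t0; have := ix t; rewrite big1 => [|j _].
    by rewrite subr0 memv0 => /eqP.
  have -> : i j t = 0 by apply: contrapT => y0; apply: H; exists j.
  by rewrite sact0l.
have [il ia] := ih j.
have py : smul p (i j t : B) = 0 by have := ia p t; rewrite pt (lin0 il) => /esym.
have [s ys] : exists s : S, sact (i j t : B) s <> 0.
  apply: contrapT => H; apply: yj; rewrite -[LHS]pP // => s.
  by apply: contrapT => z; apply: H; exists s.
exists (fun v => sact (i j v : B) s); last by exists t.
split=> [|a v]; first exact: (lin_comp (sact_linear_l s) il).
by rewrite ia [sact a (i j v)]/(smul a (i j v : B)) sactA.
Qed.

End Annihilator.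

(** Supermodules given by matrices, acting on row vectors from the right.  In this
    form submodules and quotients are the diagonal blocks in an adapted basis. *)
Record srep (F : fieldType) (B : superAlgType F) (n : nat) := SRep {
  rho : B -> 'M[F]_n;
  prt : bool -> 'M[F]_n;
  rho_linear : linear rho;
  rho1 : rho sone = 1%:M;
  rhoM : forall a b, rho (smul a b) = rho b *m rho a;
  prtK : forall b c, prt c *m prt b = if b == c then prt c else 0;
  prtD : prt false + prt true = 1%:M;
  rho_homog : forall b c x, homog b x ->
    prt c *m rho x *m prt (b (+) c) = prt c *m rho x
}.

Definition srep_mod F B n (r : @srep F B n) : Type := 'rV[F]_n.

Section SrepModule.
Variables (F : fieldType) (B : superAlgType F) (n : nat) (r : srep B n).

HB.instance Definition _ := Vector.copy (srep_mod r) 'rV[F]_n.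

Let sp b (v : srep_mod r) : srep_mod r := v *m prt r b.
Let ac a (v : srep_mod r) : srep_mod r := v *m rho r a.

Let sp_linear b : linear (sp b). Proof. exact: (linearP (mulmxr _)). Qed.
Let spK b c v : sp b (sp c v) = if b == c then sp c v else 0.
Proof. by rewrite /sp -mulmxA prtK; case: eqP => // _; rewrite mulmx0. Qed.
Let spD v : sp false v + sp true v = v.
Proof. by rewrite /sp -mulmxDr prtD mulmx1. Qed.

HB.instance Definition _ :=
  isSuperSpace.Build F (srep_mod r) sp_linear spK spD.

Let ac_linear_l v : linear (ac^~ v).
Proof. by move=> a x y; rewrite /ac rho_linear mulmxDr -scalemxAr. Qed.
Let ac_linear_r a : linear (ac a). Proof. exact: (linearP (mulmxr _)). Qed.
Let acA a b v : ac (smul a b) v = ac a (ac b v).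
Proof. by rewrite /ac rhoM mulmxA. Qed.
Let ac1 v : ac sone v = v. Proof. by rewrite /ac rho1 mulmx1. Qed.
Let ac_homog b c x (v : srep_mod r) :
  homog b x -> homog c v -> homog (b (+) c) (ac x v).
Proof.
move=> hx hv; have vE : v *m prt r c = v := hv.
suff : v *m rho r x *m prt r (b (+) c) = v *m rho r x by [].
by rewrite -vE -!mulmxA [prt r c *m (_ *m _)]mulmxA rho_homog.
Qed.

HB.instance Definition _ :=
  isSuperModule.Build F B (srep_mod r) ac_linear_l ac_linear_r acA ac1 ac_homog.

End SrepModule.

Section Compress.
Variables (F : fieldType) (B : superAlgType F) (n m : nat) (r : srep B n).
Variables (st : 'M[F]_n -> Prop) (th : 'M[F]_n -> 'M[F]_m).
Hypotheses (st_rho : forall a, st (rho r a)) (st_prt : forall b, st (prt r b)).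
Hypothesis stM : forall X Y, st X -> st Y -> st (X *m Y).
Hypotheses (th_lin : linear th) (th1 : th 1%:M = 1%:M).
Hypothesis thM : forall X Y, st X -> st Y -> th (X *m Y) = th X *m th Y.

Let rho_lin' : linear (fun a => th (rho r a)).
Proof. exact: lin_comp th_lin (rho_linear r). Qed.
Let rho1' : th (rho r sone) = 1%:M. Proof. by rewrite rho1. Qed.
Let rhoM' a b : th (rho r (smul a b)) = th (rho r b) *m th (rho r a).
Proof. by rewrite rhoM thM. Qed.
Let prtK' b c : th (prt r c) *m th (prt r b) = if b == c then th (prt r c) else 0.
Proof. by rewrite -thM // prtK; case: eqP => // _; apply: lin0. Qed.
Let prtD' : th (prt r false) + th (prt r true) = 1%:M.
Proof. by rewrite -(linD th_lin) prtD. Qed.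
Let rho_homog' b c x : homog b x ->
  th (prt r c) *m th (rho r x) *m th (prt r (b (+) c)) = th (prt r c) *m th (rho r x).
Proof.
by move=> hx; rewrite -!thM ?rho_homog //; apply: stM.
Qed.

(** Taking th to be the projection onto either diagonal block of a triangular
    form, this gives the submodule and the quotient module. *)
Definition compress : srep B m :=
  SRep rho_lin' rho1' rhoM' prtK' prtD' rho_homog'.

End Compress.

Lemma rowspace_of_set (F : fieldType) n (U : set 'rV[F]_n) : U 0 ->
  (forall a u v, U u -> U v -> U (a *: u + v)) ->
  exists k (W : 'M[F]_(k, n)), forall v, (v <= W)%MS <-> U v.
Proof.
move=> U0 Ul; have [W WP] := vspace_of_set U0 Ul.
exists (\dim W), (\matrix_i (vbasis W)`_i) => v; rewrite -WP; split.
  move=> /submxP[c ->]; rewrite mulmx_sum_row; apply: memv_suml => i _.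
  by rewrite rowK memvZ // vbasis_mem // mem_nth // size_tuple.
move=> vW; rewrite (coord_vbasis vW); apply: summx_sub => i _.
by apply: scalemx_sub; apply: (eq_row_sub i); rewrite rowK.
Qed.

Lemma det_intertwine (F : fieldType) n m (H : 'M[F]_(n, m)) (G : 'M[F]_(m, n))
    (X : 'M[F]_n) (Y : 'M[F]_m) :
  H *m G = 1%:M -> G *m H = 1%:M -> X *m H = H *m Y -> \det X = \det Y.
Proof.
move=> HG GH e; have nm : n = m.
  by apply/eqP; rewrite eqn_leq (mulmx1_min HG) (mulmx1_min GH).
subst m; have -> : X = H *m Y *m G by rewrite -e -mulmxA HG mulmx1.
by rewrite !det_mulmx mulrAC -det_mulmx HG det1 mul1r.
Qed.

Section Triangular.
Variables (F : fieldType) (n u d : nat).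
Variables (R1 : 'M[F]_(u, n)) (H : 'M[F]_(u + d, n)) (G : 'M[F]_(n, u + d)).
Hypotheses (HR : usubmx H = R1) (HG : H *m G = 1%:M) (GH : G *m H = 1%:M).

Definition stab (X : 'M[F]_n) := (R1 *m X <= R1)%MS.
Definition adapted (X : 'M[F]_n) : 'M[F]_(u + d) := H *m X *m G.
Definition subpart X := ulsubmx (adapted X).
Definition quopart X := drsubmx (adapted X).

Lemma adaptedM X Y : adapted (X *m Y) = adapted X *m adapted Y.
Proof.
by rewrite /adapted !mulmxA -[H *m X *m G *m H]mulmxA GH mulmx1.
Qed.

Lemma adapted_linear : linear adapted.
Proof.
by move=> a X Y; rewrite /adapted mulmxDr mulmxDl -scalemxAr -scalemxAl.
Qed.

Lemma adapted_ur X : stab X -> ursubmx (adapted X) = 0.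
Proof.
move=> /submxP[Y e]; rewrite /ursubmx /adapted -!mul_usub_mx HR e.
rewrite -mulmxA -HR mul_usub_mx HG -mulmx_rsub.
have -> : rsubmx (usubmx (1%:M : 'M[F]_(u + d))) = 0.
  by rewrite -/(ursubmx _) scalar_mx_block block_mxKur.
by rewrite mulmx0.
Qed.

Lemma stabM X Y : stab X -> stab Y -> stab (X *m Y).
Proof.
by move=> sX sY; rewrite /stab mulmxA; apply: submx_trans sY; apply: submxMr.
Qed.

Lemma det_adapted X : stab X -> \det X = \det (subpart X) * \det (quopart X).
Proof.
move=> sX; rewrite -(det_lblock _ (dlsubmx (adapted X))) (det_intertwine (Y := adapted X) GH HG).
  by rewrite -[in LHS](submxK (adapted X)) adapted_ur.
by rewrite /adapted !mulmxA GH mul1mx.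
Qed.

Lemma subpartM X Y : stab X -> stab Y -> subpart (X *m Y) = subpart X *m subpart Y.
Proof.
move=> sX sY; rewrite /subpart adaptedM.
rewrite -{1}[adapted X]submxK -{1}[adapted Y]submxK mulmx_block !block_mxKul.
by rewrite adapted_ur // mul0mx addr0.
Qed.

Lemma quopartM X Y : stab X -> stab Y -> quopart (X *m Y) = quopart X *m quopart Y.
Proof.
move=> sX sY; rewrite /quopart adaptedM.
rewrite -{1}[adapted X]submxK -{1}[adapted Y]submxK mulmx_block !block_mxKdr.
by rewrite adapted_ur // mulmx0 add0r.
Qed.

Lemma subpart_linear : linear subpart.
Proof. by move=> a X Y; rewrite /subpart /ulsubmx adapted_linear !linearP. Qed.
Lemma quopart_linear : linear quopart.
Proof. by move=> a X Y; rewrite /quopart /drsubmx adapted_linear !linearP. Qed.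
Lemma adapted1 : adapted 1%:M = 1%:M.
Proof. by rewrite /adapted mulmx1. Qed.
Lemma subpart1 : subpart 1%:M = 1%:M.
Proof. by rewrite /subpart adapted1 scalar_mx_block block_mxKul. Qed.
Lemma quopart1 : quopart 1%:M = 1%:M.
Proof. by rewrite /quopart adapted1 scalar_mx_block block_mxKdr. Qed.

End Triangular.

(** A multiplicative condition on the determinant of a holds on every module once
    it holds on the simple ones: determinants are multiplicative along a
    composition series. *)
Lemma det_by_simples (F : fieldType) (B : superAlgType F) (a : B) (P : F -> Prop) :
  P 1 -> (forall x y, P x -> P y -> P (x * y)) ->
  (forall n (r : srep B n), simple_mod (srep_mod r : superModType B) ->
     P (\det (rho r a))) ->
  forall n (r : srep B n), P (\det (rho r a)).
Proof.
move=> P1 PM Ps n; have [N] := ubnP n; elim: N n => // N IH n /ltnSE nN r.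
have [sr|nsr] := EM (simple_mod (srep_mod r : superModType B)); first exact: Ps.
have [v0|nz] := EM (exists v : srep_mod r, v <> 0); last first.
  have n0 : n = 0.
    apply/eqP; rewrite -leqn0 leqNgt; apply/negP => n_gt0; apply: nz.
    exists (delta_mx 0 (Ordinal n_gt0)) => /rowP/(_ (Ordinal n_gt0))/eqP.
    by rewrite !mxE !eqxx oner_eq0.
  by move: r {nsr nz}; rewrite n0 => r; rewrite det_mx00.
have [U [gU U0 UT]] : exists U : set (srep_mod r),
    [/\ graded_submodule U, U <> [set 0]%classic & U <> setT].
  apply: contrapT => H; apply: nsr; split=> // U gU; apply: contrapT => nU.
  by apply: H; exists U; split=> // e; apply: nU; [left|right].
have [U00 UD UZ UA Us] := gU.
have [|k [W WP]] := @rowspace_of_set F n U U00.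
  by move=> c x y Ux Uy; apply: UD => //; apply: UZ.
(* H is a basis of row vectors starting with a basis of U. *)
pose u := \rank W; pose d := \rank (W^C)%MS.
pose R1 : 'M_(u, n) := row_base W; pose R2 : 'M_(d, n) := row_base (W^C)%MS.
have R1W v : (v <= R1)%MS = (v <= W)%MS by rewrite eq_row_base.
pose H := col_mx R1 R2.
have Hfull : row_full H.
  rewrite -sub1mx -addsmxE.
  apply: submx_trans (addsmxS _ _ : (W + W^C <= _)%MS); rewrite ?eq_row_base //.
  by rewrite sub1mx addsmx_compl_full.
have ud : (u + d)%N = n by rewrite /u /d mxrank_compl subnKC ?rank_leq_col.
have Hfree : row_free H by rewrite /row_free (eqP Hfull) ud.
have [G HG] := row_freeP Hfree; have [G' G'H] := row_fullP Hfull.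
have GH : G *m H = 1%:M.
  suff -> : G = G' by [].
  by rewrite -[G']mulmx1 -HG mulmxA G'H mul1mx.
have HR : usubmx H = R1 by rewrite col_mxKu.
have st X : (forall v, U v -> U (v *m X)) -> stab R1 X.
  move=> UX; apply/row_subP => i; rewrite row_mul R1W; apply/WP/UX/WP.
  by rewrite -R1W row_sub.
have st_rho b : stab R1 (rho r b) by apply: st => v; apply: UA.
have st_prt b : stab R1 (prt r b) by apply: st => v; apply: Us.
have u_gt0 : (0 < u)%N.
  rewrite lt0n mxrank_eq0; apply/eqP => W0; apply: U0.
  apply/seteqP; split=> [v /WP vW|_ ->//].
  by apply: (@submx0null _ _ k); rewrite -W0.
have d_gt0 : (0 < d)%N.
  rewrite lt0n; apply/eqP => d0; apply: UT; apply/seteqP; split=> // v _.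
  apply/WP; apply: submx_full; rewrite /row_full -/u.
  by rewrite -[X in _ == X]ud d0 addn0.
have un : (u < N)%N by apply: leq_trans nN; rewrite -ud -addn1 leq_add2l.
have dn : (d < N)%N by apply: leq_trans nN; rewrite -ud -add1n leq_add2r.
rewrite (det_adapted HR HG GH (st_rho a)).
apply: PM.
  exact: (IH _ un (compress st_rho st_prt (@stabM _ _ _ R1) (subpart_linear H G)
    (subpart1 HG) (subpartM HR HG GH)) ).
exact: (IH _ dn (compress st_rho st_prt (@stabM _ _ _ R1) (quopart_linear H G)
    (quopart1 HG) (quopartM HR HG GH)) ).
Qed.

(** * Every simple module of the reduction lifts *)

Section ExtRep.
Variables (O : comNzRingType) (K : fieldType) (iota : {rmorphism O -> K}).
Variables (A : superAlgType O) (M : superModType A).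
Local Notation B := (ext iota A).

Let rh (a : B) : 'M[K]_(dim M) := emx (sact a : ext iota M -> ext iota M).
Let pr b : 'M[K]_(dim M) := emx (@spart K (ext iota M) b).

Let rhP a (x : ext iota M) : ecoor (sact a x) = ecoor x *m rh a.
Proof. exact: (emxP x (sact_linear_r a)). Qed.
Let prP b (x : ext iota M) : ecoor (spart b x) = ecoor x *m pr b.
Proof. exact: (emxP x (@spart_is_linear _ _ b)). Qed.

Let eq_mx (X Y : 'M[K]_(dim M)) :
  (forall x : ext iota M, ecoor x *m X = ecoor x *m Y) -> X = Y.
Proof. by move=> H; apply: eq_mulmx_row => u; rewrite -[u](@edecodeK _ _ iota M). Qed.

Let rh_linear : linear rh.
Proof.
move=> r a b; apply: eq_mx => x; rewrite mulmxDr -scalemxAr -!rhP.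
by rewrite sactDl sactZl ecoor_linear.
Qed.
Let rh1 : rh sone = 1%:M.
Proof. by apply: eq_mx => x; rewrite -rhP sact1 mulmx1. Qed.
Let rhM a b : rh (smul a b) = rh b *m rh a.
Proof. by apply: eq_mx => x; rewrite mulmxA -!rhP sactA. Qed.
Let prK b c : pr c *m pr b = if b == c then pr c else 0.
Proof.
apply: eq_mx => x; rewrite mulmxA -!prP spartK; case: eqP => _ //.
by rewrite mulmx0 (lin0 (@ecoor_linear _ _ _ _)).
Qed.
Let prD : pr false + pr true = 1%:M.
Proof.
apply: eq_mx => x; rewrite mulmxDr -!prP mulmx1.
by rewrite -(linD (@ecoor_linear _ _ _ _)) spartD.
Qed.
Let rh_homog b c x : homog b x -> pr c *m rh x *m pr (b (+) c) = pr c *m rh x.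
Proof.
move=> hx; apply: eq_mx => y; rewrite !mulmxA -prP -rhP -prP.
by congr ecoor; apply: (sact_homog _ _ _ _ hx (spart_homog c y)).
Qed.

Definition srep_of_ext : srep B (dim M) := SRep rh_linear rh1 rhM prK prD rh_homog.

Lemma srep_of_ext_tens1 a :
  rho srep_of_ext (tens1 iota a) = map_mx iota (actmx M a).
Proof. by apply: eq_mx => x; rewrite -ecoor_sact -rhP. Qed.

End ExtRep.

Section Surjectivity.
Variables (O : comNzRingType) (K k : fieldType).
Variables (iota : {rmorphism O -> K}) (res : {rmorphism O -> k}).
Variables (A : superAlgType O).
Hypotheses (iota_inj : injective iota) (ssA : semisimple (ext res A)).
Hypothesis res_surj : forall y, exists x, res x = y.

Lemma tens1_surj (M : vectType O) (x : ext res M) : exists v, x = tens1 res v.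
Proof.
have /choice[s sP] := res_surj.
exists (r2v (map_mx s (ecoor x))); apply: (can_inj (@ecoorK _ _ _ M)).
by rewrite ecoor_tens1 r2vK; apply/rowP => i; rewrite !mxE sP.
Qed.

(** Let c in A lift the identity of the annihilator of S.  If S receives no nonzero
    map from the reduction of a lattice in a simple module, c is invertible on all
    these reductions, so its determinant on every simple module over K comes from
    an element of O with nonzero residue.  The same then holds on the regular
    module, so c is invertible on its reduction; but c kills S. *)
Lemma simple_lifts (tilde : superModType (ext iota A) -> superModType A)
    (tildeP : forall V, siso (ext iota (tilde V) : superModType (ext iota A)) V)
    (S : superModType (ext res A)) : simple_mod S ->
  exists2 V, simple_mod V &
    exists2 f : ext res (tilde V) -> S, mhom f & exists v, f v <> 0.
Proof.
move=> [[s0 s0n0] _]; apply: contrapT => noV.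
have [p pS pP] := annihilator_left_identity ssA S.
have [c cE] := tens1_surj p.
pose P z := exists2 d : O, iota d = z & res d <> 0.
(* The determinant of c is a residual unit on every module over K. *)
have detP n (r : srep (ext iota A) n) : P (\det (rho r (tens1 iota c))).
  apply: det_by_simples => [|_ _ [x <- x0] [y <- y0]|{}n {}r sr].
  - by exists 1; rewrite rmorph1 //; apply/eqP; apply: oner_neq0.
  - by exists (x * y); rewrite rmorphM //; apply/eqP; rewrite mulf_neq0 //; apply/eqP.
  pose V : superModType (ext iota A) := srep_mod r.
  have [e [f [[fl fa] _ [g fK gK]]]] := siso_degree sr (siso_sym (tildeP V)).
  exists (\det (actmx (tilde V) c)).
    rewrite -det_map_mx; pose H : 'M_(dim (tilde V), n) := \matrix_i g (ebasis iota i).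
    pose G : 'M_(n, dim (tilde V)) := \matrix_i ecoor (f (delta_mx 0 i : 'rV_n)).
    have gl : linear g.
      by move=> a u v; apply: (can_inj fK); rewrite fl !gK.
    have HP x : g x = ecoor x *m H :> 'rV_n.
      rewrite -{1}[x]ecoorK /edecode (lin_sum gl) mulmx_sum_row.
      by apply: eq_bigr => i _; rewrite (linZ gl) rowK.
    have GP (v : 'rV_n) : ecoor (f v) = v *m G.
      rewrite {1}[v]row_sum_delta (lin_sum fl) (lin_sum (@ecoor_linear _ _ _ _)).
      rewrite mulmx_sum_row; apply: eq_bigr => i _.
      by rewrite (linZ fl) (linZ (@ecoor_linear _ _ _ _)) rowK.
    apply/esym/(@det_intertwine _ _ _ G H).
    - by apply: eq_mulmx_row => v; rewrite mulmxA -GP -HP fK mulmx1.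
    - apply: eq_mulmx_row => v; rewrite -[v](@edecodeK _ _ iota (tilde V)) mulmxA.
      by rewrite -HP -GP gK mulmx1.
    apply: eq_mulmx_row => v; rewrite !mulmxA -GP -[v *m G]GP -ecoor_sact.
    by congr ecoor; apply: fa.
  rewrite -det_map_mx => /eqP/det0P[w w0 wM].
  apply: noV; exists V => //.
  apply: (block_hom ssA pP (t := edecode res w)) => [e0|].
    by case/eqP: w0; rewrite -[w](@edecodeK _ _ res (tilde V)) e0
      (lin0 (@ecoor_linear _ _ _ _)).
  apply: (can_inj (@ecoorK _ _ _ (tilde V))); rewrite cE ecoor_sact edecodeK wM.
  by rewrite (lin0 (@ecoor_linear _ _ _ _)).
(* On the regular module this makes p invertible, although p kills S. *)
have [d dE d0] := detP _ (srep_of_ext iota (reg A)).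
move: dE; rewrite srep_of_ext_tens1 det_map_mx => /iota_inj dE.
have cU : map_mx res (actmx (reg A) c) \in unitmx.
  by rewrite unitmxE det_map_mx -dE unitfE; apply/eqP.
pose x : ext res (reg A) :=
  edecode res (ecoor (tens1 res (sone : reg A)) *m invmx (map_mx res (actmx (reg A) c))).
have px : smul p (x : ext res A) = sone.
  have : sact (tens1 res c) x = tens1 res (sone : reg A).
    apply: (can_inj (@ecoorK _ _ _ (reg A))).
    by rewrite ecoor_sact edecodeK mulmxKV.
  by rewrite -cE.
by apply: s0n0; rewrite -[s0]sact1 -px sactA pS.
Qed.

End Surjectivity.

(** * The bijection *)

Lemma siso_nonzero (F : fieldType) (B : superAlgType F) (T S : superModType B) :
  simple_mod T -> siso T S -> exists2 f : T -> S, mhom f & exists v, f v <> 0.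
Proof.
move=> sT /(siso_degree sT)[d [f [fh _ /bij_inj fI]]]; have [fl _] := fh.
exists f => //; have [[v v0] _] := sT; exists v => e; apply: v0; apply: fI.
by rewrite e (lin0 fl).
Qed.

Theorem theorem2p19
    (O : idomainType) (m : set O) (k : fieldType) (res : {rmorphism O -> k})
    (A : superAlgType O)
    (tilde : forall V : superModType (ext (frac_map O) A), lattice V) :
  let KA : superAlgType {fraction O} := ext (frac_map O) A in
  let kA : superAlgType k := ext res A in
  let red (V : superModType KA) : superModType kA := ext res (tilde V) in
  is_DVR m -> is_residue_field m res -> 2%N \notin [pchar k] ->
  split_alg kA -> split_alg KA -> semisimple kA ->
  ((forall V : superModType KA, simple_mod V -> typeM V) ->
     (forall (I J : Type) (V : I -> superModType KA) (S : J -> superModType kA),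
        is_Irr V -> is_Irr S ->
        exists f : I -> J, bijective f /\
          forall i, siso (red (V i)) (S (f i))) /\
     (forall S : superModType kA, simple_mod S -> typeM S)) /\
  (adic_complete m ->
     forall (I J : Type) (V : I -> superModType KA) (S : J -> superModType kA),
       is_Irr V -> is_Irr S ->
       exists f : I -> J, bijective f /\
         forall i, [/\ siso (red (V i)) (S (f i)),
                       typeM (V i) -> typeM (S (f i))
                     & typeQ (V i) -> typeQ (S (f i))]).
Proof.
move=> KA kA red _ [res_surj _] _ _ spK ssA.
pose iota := frac_map O.
have iota_inj : injective iota by move=> x y /eqP; rewrite tofrac_eq => /eqP.
pose lift V : superModType KA := ext iota (tilde V).
have liftP V : siso (lift V) V := lat_span (tilde V).
have lift_simple V : simple_mod V -> simple_mod (lift V).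
  by move=> sV; apply: simple_siso sV (siso_sym (liftP V)).
have red_simple V : simple_mod V -> simple_mod (red V).
  move=> /lift_simple sL; apply: (simple_reduction iota_inj ssA) => [|f fh fd].
    by case: sL.
  exact: split_even_scalar sL (spK _ sL) f fh fd.
have red_endo V n : endo_dim V n -> endo_dim (red V) n.
  move=> /(endo_dim_siso (siso_sym (liftP V))).
  exact: endo_dim_reduction.
have lift_red V W : simple_mod V -> simple_mod W ->
    siso V W <-> siso (red V) (red W).
  move=> sV sW; split=> [iVW|/(siso_nonzero (red_simple _ sV)) hr].
    have iL : siso (lift V) (lift W).
      exact: siso_trans (siso_trans (liftP V) iVW) (siso_sym (liftP W)).
    have hL := siso_nonzero (lift_simple _ sV) iL.
    have [f fh f0] := (hom_nonzero_reduction iota_inj ssA _ _).1 hL.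
    exact: schur (red_simple _ sV) (red_simple _ sW) fh f0.
  have [f fh f0] := (hom_nonzero_reduction iota_inj ssA _ _).2 hr.
  have iL := schur (lift_simple _ sV) (lift_simple _ sW) fh f0.
  exact: siso_trans (siso_trans (siso_sym (liftP V)) iL) (liftP W).
have red_surj S : simple_mod S -> exists2 V, simple_mod V & siso (red V) S.
  move=> sS; have [V sV [f fh f0]] := simple_lifts iota_inj ssA res_surj liftP sS.
  by exists V => //; apply: schur fh f0 => //; apply: red_simple.
have bij (I J : Type) (V : I -> superModType KA) (S : J -> superModType kA) :
    is_Irr V -> is_Irr S ->
    exists f : I -> J, bijective f /\ forall i, siso (red (V i)) (S (f i)).
  move=> [sV injV surjV] [sS injS surjS].
  have /choice[f fP] : forall i, exists j, siso (red (V i)) (S j).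
    by move=> i; apply: surjS; apply: red_simple.
  exists f; split=> //; apply: inj_surj_bij => [i i' e|j].
    apply: injV; apply/lift_red => //; apply: siso_trans (fP i) _.
    by rewrite e; apply: siso_sym.
  have [W sW iW] := red_surj _ (sS j); have [i iWV] := surjV W sW.
  exists i; apply: injS; apply: siso_trans (siso_sym (fP i)) _.
  by apply: siso_trans (siso_sym _) iW; apply/lift_red.
split=> [allM|_ I J V S irrV irrS].
  split=> // S sS; have [V sV iVS] := red_surj S sS.
  by apply: endo_dim_siso iVS _; apply: red_endo; apply: allM.
have [f [fb fP]] := bij I J V S irrV irrS; exists f; split=> // i.
by split=> // tV; apply: endo_dim_siso (fP i) _; apply: red_endo.
Qed.
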